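(* Let $\mathbb{K}$ be an imaginary-quadratic number field of discriminant $d_{\mathbb{K}}$, and let $n$ be a positive integer. Then the field extension $\widehat{\mathbb{K}}_n\supseteq\mathbb{Q}$, where $$\widehat{\mathbb{K}}_n=\widehat{\mathbb{K}}(\Delta_{n,\mathbb{K}}^{*}):=\mathbb{Q}\big(m_{ij}\;;\;M=(m_{ij})\in\Delta_{n,\mathbb{K}}^{*},\ 1\leq i,j\leq 2n\big)\subseteq\mathbb{C},$$ is ramified exactly at the primes dividing $n\,d_{\mathbb{K}}$.
   Context: Write $\mathbb{K}=\mathbb{Q}(\sqrt{-m})\subseteq\mathbb{C}$ with $m\in\mathbb{N}$ squarefree. $SU(n,n;\mathbb{C})$ is the group of all $M\in SL_{2n}(\mathbb{C})$ with $\overline{M}^{tr}JM=J$, where $J=\begin{pmatrix}0&-I\\ I&0\end{pmatrix}$ with $n\times n$ blocks and $I$ the identity matrix. $\mathcal{O}_{\mathbb{K}}$ is the ring of integers of $\mathbb{K}$; for $L\in\mathcal{O}_{\mathbb{K}}^{2n\times2n}$, $\mathcal{I}(L)$ is the ideal of $\mathcal{O}_{\mathbb{K}}$ generated by the entries of $L$. The extended Hermitian modular group of degree $n$ is $$\Delta_{n,\mathbb{K}}^{*}:=\left\{\tfrac1u L\in SU(n,n;\mathbb{C})\;;\;L\in\mathcal{O}_{\mathbb{K}}^{2n\times2n},\ 0\neq u\in\mathbb{C},\ u^n\in\mathcal{O}_{\mathbb{K}},\ u^n\mathcal{O}_{\mathbb{K}}=\mathcal{I}(L)^n\right\}.$$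 The field $\widehat{\mathbb{K}}_n$ (the field of definition of $\Delta_{n,\mathbb{K}}^{*}$) is the subfield of $\mathbb{C}$ generated over $\mathbb{Q}$ by all entries of all elements of $\Delta_{n,\mathbb{K}}^{*}$.
   Formalization: The case n = 1 is excluded (n ≥ 2 is assumed): for n = 1 the group is SL_2(Z), so its field of definition is Q, which is unramified everywhere, while d_K always has a prime divisor, so the claim fails there for every K. *)

(* Defs.v *)
(* C below stands for the complex numbers R[i], R : realType. *)
From HB Require Import structures.
From mathcomp Require Import all_boot all_order all_algebra.
From mathcomp Require Import complex.
From mathcomp Require Import boolp classical_sets reals.

Set Implicit Arguments.
Unset Strict Implicit.
Unset Printing Implicit Defensive.

Import Order.TTheory GRing.Theory Num.Theory.

Local Open Scope classical_set_scope.
Local Open Scope ring_scope.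

Definition square_free (m : nat) : Prop :=
  forall k : nat, (k ^ 2 %| m)%N -> k = 1%N.

Section NumberFields.
Variable C : numClosedFieldType.

Definition is_subfield (F : set C) : Prop := divring_closed [in F].

(* Every subfield of C contains Q, so this is the field Q(S). *)
Definition adjoinQ (S : set C) : set C := smallest is_subfield S.

Definition ring_of_integers (F : set C) : set C :=
  [set x | F x /\ integralOver (intr : int -> C) x].

(* Ideals of a subring O of C, as subsets of C. *)
Definition is_ideal (O I : set C) : Prop :=
  [/\ I `<=` O, I 0,
      forall x y, I x -> I y -> I (x + y)
    & forall a x, O a -> I x -> I (a * x)].

(* Meaningful for S `<=` O only. *)
Definition ideal_gen (O S : set C) : set C := smallest (is_ideal O) S.

Definition ideal_mul (O I J : set C) : set C :=
  ideal_gen O [set x | exists2 a, I a & exists2 b, J b & x = a * b].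

Definition ideal_exp (O I : set C) (k : nat) : set C :=
  iter k (ideal_mul O I) O.

Definition is_prime_ideal (O P : set C) : Prop :=
  [/\ is_ideal O P, ~ P 1
    & forall x y, O x -> O y -> P (x * y) -> P x \/ P y].

(* The ramification index of a prime P of O_F above p is the largest e with
   p O_F `<=` P ^ e; F / Q is ramified at p when it exceeds 1 for some P.
   (P ^ 2 `<=` P, so that P does lie above p.  No residue field condition is
   needed, finite fields being perfect.) *)
Definition ramified_at (F : set C) (p : nat) : Prop :=
  let O := ring_of_integers F in
  exists2 P, is_prime_ideal O P
    & ideal_gen O [set p%:R] `<=` ideal_exp O P 2.

(* The field Q(sqrt (- m)) *)
Definition quadratic_field (m : nat) : set C := adjoinQ [set sqrtC (- m%:R)].

Definition is_integral_basis2 (F : set C) (w : 'I_2 -> C) : Prop :=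
  [/\ forall j, ring_of_integers F (w j),
      forall x, ring_of_integers F x ->
        exists a : 'I_2 -> int, x = \sum_j (a j)%:~R * w j
    & forall a : 'I_2 -> int, \sum_j (a j)%:~R * w j = 0 -> forall j, a j = 0].

(* d = det (s_i (w_j)) ^ 2 for an integral basis (w_0, w_1) of F, where s_0, s_1
   are the embeddings of F in C; for an imaginary-quadratic F these are the
   inclusion and complex conjugation. *)
Definition is_discriminant (F : set C) (d : int) : Prop :=
  exists2 w, is_integral_basis2 F w
    & d%:~R = (\det (\matrix_(i < 2, j < 2)
                       (if i == 0 then w j else (w j)^*))) ^+ 2.

End NumberFields.

Section HermitianModularGroup.
Variables (C : numClosedFieldType) (n : nat).

Definition Jmx : 'M[C]_(n + n) := block_mx 0 (- 1%:M) 1%:M 0.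

Definition SUnn : set 'M[C]_(n + n) :=
  [set M | \det M = 1 /\ (map_mx Num.conj M)^T *m Jmx *m M = Jmx].

Definition entries_ideal (O : set C) (L : 'M[C]_(n + n)) : set C :=
  ideal_gen O [set x | exists i j, x = L i j].

Definition extended_hermitian_modular_group (K : set C) : set 'M[C]_(n + n) :=
  let O := ring_of_integers K in
  [set M | SUnn M /\
    exists (u : C) (L : 'M[C]_(n + n)),
      [/\ M = u^-1 *: L,
          forall i j, O (L i j),
          u != 0,
          O (u ^+ n)
        & ideal_gen O [set u ^+ n] = ideal_exp O (entries_ideal O L) n]].

(* For n = 1 and K imaginary-quadratic the group is SL_2(Z), with field of
   definition Q; for n > 1 the field contains K. *)
Definition field_of_definition (G : set 'M[C]_(n + n)) : set C :=
  adjoinQ [set x | exists2 M, G M & exists i j, x = M i j].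

End HermitianModularGroup.

(* Main.v *)
(* Unramified part.  For p prime to n d, every algebraic integer x of the field
   satisfies x^q = x modulo p for some power q > 1 of p; then every prime P over
   p is generated by p locally, and p is not in P^2.  The property holds for K
   because p does not divide d, and it passes from E to E(v) when v^n is in K
   and v v^* is an integer prime to p: with h = X^n - v^n, Euler's formula puts
   h'(v) x in O_E[v] for every integer x of E(v), h'(v) divides an integer prime
   to p, and v is a root of unity of order prime to p modulo p.  The entries of
   M = L / u in the group are algebraic integers, because the ideal equation
   makes (l / u)^n integral for every entry l of L.  By unitarity the products
   of an entry and a conjugate entry are not all divisible by p, so some
   combination v of two entries has v v^* prime to p, and all entries lie in K v.

   Ramified part.  The scalar matrices u with u^n = 1 or -1 and the translation
   by an off-diagonal Hermitian matrix show that the field contains sqrt(-m), the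
   n-th roots of unity and, for n even, i.  An explicit identity in terms of one
   of sqrt(-m), 1 + sqrt(-m), 1 - zeta_p, 1 + i puts p in P^2 for every prime P
   over p. *)
Require Import Defs.
From HB Require Import structures.
From mathcomp Require Import all_boot all_order all_algebra.
From mathcomp Require Import all_solvable all_field.
From mathcomp Require Import complex.
From mathcomp Require Import boolp classical_sets reals.
From mathcomp Require Import zify ring.

Set Implicit Arguments.
Unset Strict Implicit.
Unset Printing Implicit Defensive.

Import Order.TTheory GRing.Theory Num.Theory.

Local Open Scope ring_scope.

(** * Algebraic integers and congruences modulo a rational prime *)

Section AlgebraicIntegers.
Variable C : numClosedFieldType.
Implicit Types (x y z : C) (p : nat).

(** Made boolean so that the closure lemmas for subring predicates apply. *)
Definition aint : {pred C} := [pred x | `[< integralOver (intr : int -> C) x >]].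

Lemma aintP x : reflect (integralOver (intr : int -> C) x) (x \in aint).
Proof. exact: asboolP. Qed.

Fact aint_subring_closed : subring_closed aint.
Proof.
split; first by apply/aintP; exact: integral1.
  by move=> x y /aintP hx /aintP hy; apply/aintP; exact: integral_sub.
by move=> x y /aintP hx /aintP hy; apply/aintP; exact: integral_mul.
Qed.
HB.instance Definition _ :=
  GRing.isSubringClosed.Build C aint aint_subring_closed.

Lemma aint_root_monic (h : {poly C}) x :
  h \is monic -> h \is a polyOver aint -> root h x -> x \in aint.
Proof.
move=> hm /polyOverP hi hx; apply/aintP; apply: (integral_root_monic hm hx).
by move=> _ /(nthP 0)[i _ <-]; apply/aintP; exact: hi.
Qed.

Lemma aint_sqr_neg_nat x k : x ^+ 2 = - k%:R -> x \in aint.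
Proof.
move=> x2; apply: (@aint_root_monic ('X^2 + (k%:R)%:P)).
- by rewrite monicXnaddC.
- by rewrite polyOverXnaddC rpred_nat.
- by rewrite rootE !hornerE x2 addNr.
Qed.

(** Over the algebraically closed [C], [h] is the product of the [X - x] over its roots. *)
Lemma polyOver_aint_roots (h : {poly C}) :
  h \is monic -> (forall x, root h x -> x \in aint) -> h \is a polyOver aint.
Proof.
move=> hm hr; have [r def_h] := closed_field_poly_normal h.
rewrite (monicP hm) scale1r in def_h; rewrite def_h big_seq.
apply: rpred_prod => x xr; rewrite polyOverXsubC; apply: hr.
by rewrite def_h root_prod_XsubC.
Qed.

Lemma aint_conj x : x \in aint -> x^* \in aint.
Proof.
move=> /aintP[h hm hx]; apply/aintP; exists h => //.
rewrite -(fmorph_root Num.conj) -map_poly_comp in hx.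
by move: hx; rewrite (eq_map_poly (g := intr)) // => z /=; rewrite rmorph_int.
Qed.

(** The integral equation of [q] also holds in [algC], where rational algebraic integers are known
    to be integers. *)
Lemma aint_ratr (q : rat) : ratr q \in aint -> q \is a Num.int.
Proof.
move=> /aintP[h hm hx].
have hq : root (map_poly intr h) q.
  rewrite -(fmorph_root (ratr : rat -> C)) -map_poly_comp.
  by rewrite (eq_map_poly (g := intr)) // => z /=; rewrite ratr_int.
have : (ratr q : algC) \in Aint.
  apply: (@root_monic_Aint (map_poly intr h)).
  - rewrite -(fmorph_root (ratr : rat -> algC)) -map_poly_comp in hq.
    by move: hq; rewrite (eq_map_poly (g := intr)) // => z /=; rewrite ratr_int.
  - exact: monic_map.
  - by apply/polyOverP => i; rewrite coef_map /= rpred_int.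
move=> /(Cint_rat_Aint (Crat_rat q))/intrP[z zq].
apply/intrP; exists z; apply: (fmorph_inj (ratr : rat -> algC)).
by rewrite /= zq ratr_int.
Qed.

Lemma aint_intdiv (a b : int) :
  b != 0 -> (a%:~R / b%:~R : C) \in aint -> (b %| a)%Z.
Proof.
move=> b0; have -> : (a%:~R / b%:~R : C) = ratr (a%:~R / b%:~R).
  by rewrite fmorph_div /= !ratr_int.
move=> /aint_ratr/intrP[c /(canRL (divfK _))].
rewrite intr_eq0 => /(_ b0); rewrite -intrM => /intr_inj ->.
exact: dvdz_mull.
Qed.

(** Divisibility by [p] is taken in the ring of all algebraic integers, so it means the same for
    every subfield of [C]. *)
Definition aint_mul p : {pred C} := [pred x | x / p%:R \in aint].

Lemma aint_mulE p x : (x \in aint_mul p) = (x / p%:R \in aint).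
Proof. by []. Qed.

Fact aint_mul_zmod_closed p : zmod_closed (aint_mul p).
Proof.
split=> [|x y]; rewrite !aint_mulE ?mul0r ?rpred0 // => hx hy.
by rewrite mulrBl rpredB.
Qed.
HB.instance Definition _ p :=
  GRing.isZmodClosed.Build C (aint_mul p) (aint_mul_zmod_closed p).

Lemma aint_mulMl p x y : x \in aint -> y \in aint_mul p -> x * y \in aint_mul p.
Proof. by rewrite !aint_mulE => hx hy; rewrite -mulrA rpredM. Qed.

Lemma aint_mulMr p x y : x \in aint -> y \in aint_mul p -> y * x \in aint_mul p.
Proof. by rewrite mulrC; exact: aint_mulMl. Qed.

Lemma aint_mul_nat p x : (0 < p)%N -> x \in aint -> p%:R * x \in aint_mul p.
Proof. by move=> p0 hx; rewrite aint_mulE mulrAC divff ?mul1r ?pnatr_eq0 -?lt0n. Qed.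

Lemma aint_mul_int p (z : int) :
  (0 < p)%N -> (z%:~R \in aint_mul p) = (p%:Z %| z)%Z.
Proof.
move=> p0; apply/idP/idP => [|/dvdzP[c ->]]; last first.
  by rewrite mulrC intrM; apply: aint_mul_nat => //; exact: rpred_int.
by rewrite aint_mulE => /(@aint_intdiv z p); apply; lia.
Qed.

(** By Bezout, a p + b z = 1 gives x = p (a x) + b (z x). *)
Lemma aint_mul_cancel p (z : int) x : prime p -> ~~ (p%:Z %| z)%Z ->
  x \in aint -> z%:~R * x \in aint_mul p -> x \in aint_mul p.
Proof.
move=> pp pz hx hzx; have p0 := prime_gt0 pp.
have /coprimezP[[a b] /= ab1] : coprimez p z.
  by rewrite coprimezE prime_coprime.
have -> : x = p%:R * (a%:~R * x) + b%:~R * (z%:~R * x).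
  transitivity ((a * p + b * z)%:~R * x); first by rewrite ab1 mul1r.
  by rewrite intrD !intrM; ring.
apply: rpredD; last exact: aint_mulMl (rpred_int _ _) hzx.
by apply: aint_mul_nat => //; rewrite rpredM ?rpred_int.
Qed.

Lemma aint_mulXB p x y k : x \in aint -> y \in aint ->
  x - y \in aint_mul p -> x ^+ k - y ^+ k \in aint_mul p.
Proof.
move=> hx hy hxy; rewrite subrXX; apply: aint_mulMr => //.
by apply: rpred_sum => i _; rewrite rpredM ?rpredX.
Qed.

(** The congruence for [k] is raised to the p-th power; the inner terms of the binomial expansion
    then carry coefficients divisible by [p]. *)
Lemma aint_mul_FrobeniusD p k x y : prime p -> x \in aint -> y \in aint ->
  (x + y) ^+ (p ^ k) - (x ^+ (p ^ k) + y ^+ (p ^ k)) \in aint_mul p.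
Proof.
move=> pp hx hy; elim: k => [|k IHk]; first by rewrite !expr1 subrr rpred0.
have := aint_mulXB p _ _ IHk; rewrite -!exprM -expnSr => IH.
rewrite -(subrKA ((x ^+ (p ^ k) + y ^+ (p ^ k)) ^+ p)).
apply: rpredD; first by apply: IH; rewrite ?rpredX ?rpredD ?rpredX.
rewrite exprDn -(prednK (prime_gt0 pp)) big_ord_recl big_ord_recr /=.
rewrite (prednK (prime_gt0 pp)) /bump /= add1n prednK ?prime_gt0 //.
rewrite subn0 subnn bin0 binn !expr0 mulr1 mul1r !mulr1n -!exprM -!expnSr.
set s := \sum_(i < _) _.
have -> a b : a + (s + b) - (a + b) = s by ring.
apply: rpred_sum => i _; rewrite add1n -mulr_natl.
have /dvdnP[c ->] : (p %| 'C(p, i.+1))%N.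
  by apply: prime_dvd_bin => //; have := ltn_ord i; have := prime_gt0 pp; lia.
rewrite mulnC natrM -mulrA; apply: aint_mul_nat; first exact: prime_gt0.
by rewrite !rpredM ?rpredX ?rpred_nat.
Qed.

End AlgebraicIntegers.
Arguments aint {C}.
Arguments aint_mul {C} p.

(** * Integers fixed modulo p by a power of Frobenius *)

Section FrobeniusPeriodic.
Variables (C : numClosedFieldType) (p : nat).
Hypothesis p_pr : prime p.
Implicit Types x y z : C.

(** An elementwise form of unramifiedness: a nilpotent class modulo [p] that some power of Frobenius
    fixes is zero. The exponent [f] may vary with [x]; two elements share the product of their
    exponents. *)
Definition Frobenius_periodic : {pred C} := [pred x | (x \in aint) &&
  `[< exists2 f, (0 < f)%N & x ^+ (p ^ f) - x \in aint_mul p >]].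

Lemma Frobenius_periodicP x :
  reflect (x \in aint /\ exists2 f, (0 < f)%N & x ^+ (p ^ f) - x \in aint_mul p)
    (x \in Frobenius_periodic).
Proof. by apply: (iffP andP) => -[xi /asboolP]. Qed.

Lemma Frobenius_periodic_aint x : x \in Frobenius_periodic -> x \in aint.
Proof. by case/Frobenius_periodicP. Qed.

Lemma Frobenius_iter x f k : x \in aint ->
  x ^+ (p ^ f) - x \in aint_mul p -> x ^+ (p ^ (f * k)) - x \in aint_mul p.
Proof.
move=> xi hx; elim: k => [|k IHk]; first by rewrite muln0 expr1 subrr rpred0.
rewrite -(subrKA (x ^+ (p ^ f))) rpredD // mulnS addnC expnD exprM.
by rewrite aint_mulXB ?rpredX.
Qed.

Lemma Frobenius_periodic2 x y :
  x \in Frobenius_periodic -> y \in Frobenius_periodic ->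
  exists f, [/\ (0 < f)%N, x ^+ (p ^ f) - x \in aint_mul p
                & y ^+ (p ^ f) - y \in aint_mul p].
Proof.
move=> /Frobenius_periodicP[xi [f f0 hf]] /Frobenius_periodicP[yi [g g0 hg]].
exists (f * g)%N; split; [by rewrite muln_gt0 f0|exact: Frobenius_iter|].
by rewrite mulnC; exact: Frobenius_iter.
Qed.

Fact Frobenius_periodic_subring_closed : subring_closed Frobenius_periodic.
Proof.
(* Additivity of Frobenius applied to x + (-x) = 0 treats p = 2 together with odd p. *)
have N x : x \in Frobenius_periodic -> - x \in Frobenius_periodic.
  move=> /Frobenius_periodicP[xi [f f0 hf]]; apply/Frobenius_periodicP.
  split; [by rewrite rpredN | exists f => //].
  have := aint_mul_FrobeniusD f p_pr xi (rpredNr xi).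
  rewrite subrr expr0n expn_eq0 (gtn_eqF (prime_gt0 p_pr)) /= => h.
  have -> : (- x) ^+ (p ^ f) - - x = - (0 - (x ^+ (p ^ f) + (- x) ^+ (p ^ f)))
    - (x ^+ (p ^ f) - x) by ring.
  by rewrite rpredB ?rpredN.
split.
- apply/Frobenius_periodicP; split; first exact: rpred1.
  by exists 1%N => //; rewrite expr1n subrr rpred0.
- move=> x y hx /N hy; have [f [f0 hxf hyf]] := Frobenius_periodic2 hx hy.
  move: hx hy => /Frobenius_periodic_aint xi /Frobenius_periodic_aint yi.
  apply/Frobenius_periodicP; split; [by rewrite rpredD | exists f => //].
  rewrite -(subrKA (x ^+ (p ^ f) + (- y) ^+ (p ^ f))) rpredD //.
    exact: aint_mul_FrobeniusD.
  by rewrite opprD addrACA rpredD.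
- move=> x y hx hy; have [f [f0 hxf hyf]] := Frobenius_periodic2 hx hy.
  move: hx hy => /Frobenius_periodic_aint xi /Frobenius_periodic_aint yi.
  apply/Frobenius_periodicP; split; [by rewrite rpredM | exists f => //].
  have -> : (x * y) ^+ (p ^ f) - x * y = (x ^+ (p ^ f) - x) * y ^+ (p ^ f)
    + x * (y ^+ (p ^ f) - y) by rewrite exprMn; ring.
  by apply: rpredD; [rewrite aint_mulMr ?rpredX | exact: aint_mulMl].
Qed.

(** Closure depends on a proof that [p] is prime, which inference cannot supply, so the structure is
    packed explicitly. *)
Definition Frobenius_periodic_ring : subringClosed C := HB.pack
  Frobenius_periodic
  (GRing.isSubringClosed.Build C Frobenius_periodic
     Frobenius_periodic_subring_closed).

Lemma Frobenius_periodicD x y : x \in Frobenius_periodic ->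
  y \in Frobenius_periodic -> x + y \in Frobenius_periodic.
Proof. exact: (@rpredD _ Frobenius_periodic_ring). Qed.

Lemma Frobenius_periodicM x y : x \in Frobenius_periodic ->
  y \in Frobenius_periodic -> x * y \in Frobenius_periodic.
Proof. exact: (@rpredM _ Frobenius_periodic_ring). Qed.

Lemma Frobenius_periodic_int (z : int) : z%:~R \in Frobenius_periodic.
Proof. exact: (rpred_int Frobenius_periodic_ring). Qed.

(** With q = p^f, [k] times (d x)^q - d x - (d^q - d) x^q equals D (x^q - x), and [D] is invertible
    modulo [p]. *)
Lemma Frobenius_periodic_cancel (D : int) x d k : ~~ (p%:Z %| D)%Z ->
  d * k = D%:~R -> k \in aint -> x \in aint ->
  d \in Frobenius_periodic -> d * x \in Frobenius_periodic ->
  x \in Frobenius_periodic.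
Proof.
move=> pD dk ki xi hd hdx; have [f [f0 hdf hdxf]] := Frobenius_periodic2 hd hdx.
apply/Frobenius_periodicP; split => //; exists f => //.
apply: (@aint_mul_cancel _ p D) => //; first by rewrite rpredB ?rpredX.
have -> : D%:~R * (x ^+ (p ^ f) - x) = k * ((d * x) ^+ (p ^ f) - d * x
   - (d ^+ (p ^ f) - d) * x ^+ (p ^ f)).
  by rewrite exprMn -dk; ring.
by rewrite aint_mulMl // rpredB // aint_mulMr ?rpredX.
Qed.

Lemma Frobenius_periodic_cancel_int (D : int) x : ~~ (p%:Z %| D)%Z ->
  x \in aint -> D%:~R * x \in Frobenius_periodic -> x \in Frobenius_periodic.
Proof.
move=> pD xi; apply: (@Frobenius_periodic_cancel D x D%:~R 1) => //.
- by rewrite mulr1.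
- exact: rpred1.
- exact: Frobenius_periodic_int.
Qed.

(* Modulo p such an x is a root of unity of order prime to p, so Euler's theorem
   gives a Frobenius power fixing it. *)
Lemma Frobenius_periodic_unity x k : (0 < k)%N -> ~~ (p %| k)%N ->
  x \in aint -> x ^+ k - 1 \in aint_mul p -> x \in Frobenius_periodic.
Proof.
move=> k0 pk xi hx; apply/Frobenius_periodicP; split => //.
exists (totient k); first by rewrite totient_gt0.
have /Euler_exp_totient/eqP : coprime p k by rewrite prime_coprime.
rewrite eqn_mod_dvd ?expn_gt0 ?prime_gt0 // => /dvdnP[c hc].
have -> : (p ^ totient k = (c * k).+1)%N.
  by rewrite -hc subn1 prednK ?expn_gt0 ?prime_gt0.
have -> : x ^+ (c * k).+1 - x = x * ((x ^+ k) ^+ c - 1).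
  by rewrite exprS mulnC exprM; ring.
rewrite aint_mulMl //.
by rewrite -[X in _ - X](expr1n _ c) aint_mulXB ?rpredX ?rpred1.
Qed.

End FrobeniusPeriodic.

(** * Polynomials over a subfield, simple extensions and Euler's formula *)

Section PolyOverSubfield.
Variables (C : numClosedFieldType) (E : divringClosed C).
Implicit Types (f g h : {poly C}) (v x : C).

(** Division takes place in C[X]; cancelling leading terms, by induction on the size of [f], shows
    that it never leaves E[X]. *)
Lemma polyOver_edivp g : g != 0 -> g \is a polyOver E ->
  forall f, f \is a polyOver E ->
  (f %/ g \is a polyOver E) /\ (f %% g \is a polyOver E).
Proof.
move=> g0 gE f; have [n] := ubnP (size f); elim: n f => // n IHn f /ltnSE fn fE.
have [fg|gf] := ltnP (size f) (size g).
  by rewrite divp_small // modp_small // rpred0.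
have f0 : (0 < size f)%N by apply: leq_trans gf; rewrite lt0n size_poly_eq0.
have g_gt0 : (0 < size g)%N by rewrite lt0n size_poly_eq0.
pose c := lead_coef f / lead_coef g; pose k := (size f - size g)%N.
pose f1 := f - (c *: 'X^k) * g.
have qE : c *: 'X^k \is a polyOver E.
  apply: polyOverZ; last exact: polyOverXn.
  by rewrite rpred_div // lead_coefE; apply/polyOverP.
have f1E : f1 \is a polyOver E by rewrite rpredB // rpredM.
have sf1 : (size f1 < n)%N.
  apply: (leq_trans _ fn); rewrite -(prednK f0) ltnS.
  apply/leq_sizeP => j hj; rewrite coefB -scalerAl coefZ coefXnM.
  have -> : (j < k)%N = false.
    by rewrite /k; lia.
  case: (ltngtP j (size f).-1) => [|hj1|->]; first by rewrite ltnNge hj.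
    have fj : (size f <= j)%N by rewrite -(prednK f0).
    have gj : (size g <= j - k)%N by rewrite /k; clear -fj gf; lia.
    by rewrite !nth_default ?mulr0 ?subr0.
  have -> : ((size f).-1 - k = (size g).-1)%N.
    by rewrite /k; lia.
  by rewrite -!lead_coefE divfK ?lead_coef_eq0 // subrr.
have [dE mE] := IHn _ sf1 f1E.
have ef : f = (c *: 'X^k + f1 %/ g) * g + f1 %% g.
  by rewrite mulrDl -addrA -divp_eq /f1 addrC subrK.
split; rewrite ef; last by rewrite modp_addl_mul_small ?ltn_modp.
by rewrite divp_addl_mul_small ?ltn_modp // rpredD.
Qed.

Lemma polyOver_divp f g :
  g \is a polyOver E -> f \is a polyOver E -> f %/ g \is a polyOver E.
Proof.
have [->|g0] := eqVneq g 0; first by rewrite divp0 rpred0.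
by move=> gE fE; have [] := polyOver_edivp g0 gE fE.
Qed.

Lemma polyOver_modp f g :
  g \is a polyOver E -> f \is a polyOver E -> f %% g \is a polyOver E.
Proof.
have [->|g0] := eqVneq g 0; first by rewrite modp0.
by move=> gE fE; have [] := polyOver_edivp g0 gE fE.
Qed.

(** A nonzero member of least degree, made monic, divides every other member by Euclidean
    division. *)
Lemma polyOver_ideal_principal (I : {poly C} -> Prop) :
  (forall f, I f -> f \is a polyOver E) ->
  (forall f g, I f -> I g -> I (f + g)) ->
  (forall f g, f \is a polyOver E -> I g -> I (f * g)) ->
  (exists2 f, I f & f != 0) ->
  exists g, [/\ g \is monic, I g & forall f, I f -> g %| f].
Proof.
move=> IE ID IM [f0 If0 f00].
have ex : exists n, `[< exists f, [/\ I f, f != 0 & size f = n] >].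
  by exists (size f0); apply/asboolP; exists f0.
case: (ex_minnP ex) => n /asboolP[g [Ig g0 sg]] gmin.
have lE : lead_coef g \in E by rewrite lead_coefE; apply/polyOverP; exact: IE.
have l0 : lead_coef g != 0 by rewrite lead_coef_eq0.
exists ((lead_coef g)^-1%:P * g); split.
- by rewrite monicE lead_coefM lead_coefC mulVf.
- by apply: IM => //; rewrite polyOverC rpredV.
- move=> f If; rewrite mul_polyC dvdpZl ?invr_eq0 //; apply/modp_eq0P/eqP.
  apply: contraT => m0.
  have Im : I (f %% g).
    have -> : f %% g = f + (- (f %/ g)) * g by rewrite {2}(divp_eq f g); ring.
    by apply: ID => //; apply: IM => //; rewrite rpredN polyOver_divp ?IE.
  have /gmin : `[< exists h, [/\ I h, h != 0 & size h = size (f %% g)] >].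
    by apply/asboolP; exists (f %% g).
  by rewrite leqNgt -sg ltn_modp g0.
Qed.

Lemma minimal_polynomial v h : h \is monic -> h \is a polyOver E -> root h v ->
  exists g, [/\ g \is monic, g \is a polyOver E, root g v
    & forall f, f \is a polyOver E -> root f v -> g %| f].
Proof.
move=> hm hE hv.
have [|f g [fE fv] [gE gv]|f g fE [gE gv]||g [gm [gE gv] gmin]] :=
    @polyOver_ideal_principal (fun f => f \is a polyOver E /\ root f v).
- by move=> f [].
- by rewrite rpredD // rootE hornerD (rootP fv) (rootP gv) addr0.
- by rewrite rpredM // rootM gv orbT.
- by exists h => //; exact: monic_neq0.
by exists g; split=> // f fE fv; exact: gmin.
Qed.

(** The ring E[v], which is a field when [v] is algebraic over [E]. *)
Definition poly_values v : set C :=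
  [set x | exists2 f, f \is a polyOver E & x = f.[v]]%classic.

Lemma poly_values_subfield v h : h \is monic -> h \is a polyOver E ->
  root h v -> is_subfield (poly_values v).
Proof.
move=> hm hE hv; have [g [gm gE gv gmin]] := minimal_polynomial hm hE hv.
(* The polynomials whose value at [v] is a multiple of f(v) in E[v] form an ideal with monic
   generator [r]. It divides both [f] and the minimal polynomial [g], and r(v) is not 0; hence [g]
   divides g / r and [r] is 1. *)
have inv f : f \is a polyOver E -> f.[v] != 0 ->
    exists2 s, s \is a polyOver E & s.[v] * f.[v] = 1.
  move=> fE fv.
  have [|a b [aE [s sE sa]] [bE [t tE tb]]|a b aE [bE [t tE tb]]||
      r [rm [rE [s sE rs]] rmin]] := @polyOver_ideal_principal (fun a =>
        a \is a polyOver E /\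
        exists2 s, s \is a polyOver E & a.[v] = s.[v] * f.[v]).
  - by move=> a [].
  - rewrite rpredD //; split=> //; exists (s + t); rewrite ?rpredD //.
    by rewrite !hornerD sa tb mulrDl.
  - rewrite rpredM //; split=> //; exists (a * t); rewrite ?rpredM //.
    by rewrite !hornerM tb mulrA.
  - exists g; last exact: monic_neq0.
    by split=> //; exists 0; rewrite ?rpred0 // horner0 mul0r; exact/rootP.
  have rg : r %| g.
    apply: rmin; split=> //; exists 0; rewrite ?rpred0 // horner0 mul0r.
    exact/rootP.
  have rf : r %| f.
    apply: rmin; split=> //; exists 1; rewrite ?rpred1 //.
    by rewrite hornerC mul1r.
  have rv : r.[v] != 0.
    apply: contraNneq fv => rv.
    by rewrite -(divpK rf) hornerM rv mulr0.
  have /dvdpP[t gt] : g %| g %/ r.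
    apply: gmin; first exact: polyOver_divp.
    move: gv; rewrite -{1}(divpK rg) rootM => /orP[//|/rootP rv0].
    by rewrite rv0 eqxx in rv.
  have tr : t * r = 1.
    apply: (mulIf (monic_neq0 gm)); rewrite mul1r -{2}(divpK rg) gt; ring.
  have r1 : r = 1.
    have : r \is a GRing.unit by apply/unitrP; exists t; rewrite [r * t]mulrC tr.
    rewrite poly_unitE => /andP[/eqP r1 _]; rewrite (size1_polyC (eq_leq r1)).
    by have := monicP rm; rewrite lead_coefE r1 => ->.
  by exists s => //; rewrite -rs r1 hornerC.
split; rewrite ?in_setE.
- by exists 1; rewrite ?rpred1 ?hornerC.
- move=> x y; rewrite !in_setE => -[a aE ->] [b bE ->].
  by exists (a - b); rewrite ?rpredB // hornerD hornerN.
- move=> x y; rewrite !in_setE => -[a aE ->] [b bE ->].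
  have [->|/(inv _ bE)[s sE sb]] := eqVneq b.[v] 0.
    by exists 0; rewrite ?rpred0 // horner0 invr0 mulr0.
  exists (a * s); rewrite ?rpredM // hornerM; congr (_ * _).
  by rewrite -[LHS]mul1r -sb mulfK //; apply: contraTneq (oner_neq0 C) => b0;
    rewrite -sb b0 mulr0 eqxx.
Qed.

(** If [P] is an integral equation of f(v), then [g] divides the composite of [P] and [f], so f(w)
    satisfies the same equation. *)
Lemma aint_conjugate f g v w : f \is a polyOver E ->
  (forall h, h \is a polyOver E -> root h v -> g %| h) -> root g w ->
  f.[v] \in aint -> f.[w] \in aint.
Proof.
move=> fE gmin gw /aintP[P Pm Pf]; apply/aintP; exists P => //.
have : g %| map_poly intr P \Po f.
  apply: gmin; last by rewrite rootE horner_comp.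
  by apply: polyOver_comp => //; apply/polyOverP => i; rewrite coef_map rpred_int.
by case/dvdpP => q eq; rewrite rootE -horner_comp eq hornerM (rootP gw) mulr0.
Qed.

(* Lagrange: [H] is the sum over [r in rs] of [f.[r]] times the cofactor of
   ['X - r%:P] in the product. *)
Lemma aint_euler f (rs : seq C) : all [pred r | r \in aint] rs ->
  all [pred r | f.[r] \in aint] rs ->
  let g := \prod_(r <- rs) ('X - r%:P) in
  exists H Q, [/\ H \is a polyOver aint, (size H <= size rs)%N
                & f * g^`() = Q * g + H].
Proof.
elim: rs => [|a rs IHrs] /=; first exists 0, 0.
  by rewrite rpred0 size_poly0 big_nil derivC mulr0 mul0r addr0.
move=> /andP[ai rsi] /andP[fai frs]; have [H [Q [Hi sH eH]]] := IHrs rsi frs.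
have /factor_theorem[f1 ef1] : root (f - f.[a]%:P) a.
  by rewrite rootE !hornerE subrr.
set g1 := \prod_(r <- rs) ('X - r%:P) in eH.
exists (f.[a] *: g1 + ('X - a%:P) * H), (f1 + Q); split.
- rewrite rpredD //; last by rewrite rpredM // polyOverXsubC.
  apply: polyOverZ => //; rewrite /g1 big_seq; apply: rpred_prod => r rr.
  by rewrite polyOverXsubC; exact: (allP rsi).
- rewrite (leq_trans (size_polyD _ _)) // geq_max.
  rewrite (leq_trans (size_scale_leq _ _)) ?size_prod_XsubC //=.
  rewrite (leq_trans (size_polyMleq _ _)) // size_XsubC; exact: sH.
- rewrite big_cons -/g1 derivM derivXsubC mul1r -mul_polyC.
  have ef : f = f1 * ('X - a%:P) + f.[a]%:P by rewrite -ef1 subrK.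
  rewrite mulrDr mulrCA eH {1}ef; ring.
Qed.

Variable p : nat.
Hypothesis p_pr : prime p.

(** Let h = q g with [g] the minimal polynomial of [v]. Euler's formula for [g] yields [H] with
    integral coefficients, and these lie in [E] because [H] is the remainder of f g' modulo [g].
    Thus h'(v) f(v) = q(v) H(v) is periodic, and h'(v) divides [D], which is prime to [p]. *)
Theorem Frobenius_periodic_adjoin v h k (D : int) :
  (forall x, x \in E -> x \in aint -> x \in Frobenius_periodic p) ->
  h \is monic -> h \is a polyOver E -> h \is a polyOver aint -> root h v ->
  v \in Frobenius_periodic p ->
  h^`().[v] * k = D%:~R -> k \in aint -> ~~ (p%:Z %| D)%Z ->
  forall x, poly_values v x -> x \in aint -> x \in Frobenius_periodic p.
Proof.
move=> UE hm hE hi hv vF hD ki pD _ [f fE ->] fi.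
have [g [gm gE gv gmin]] := minimal_polynomial hm hE hv.
have gh := gmin _ hE hv; set q := h %/ g; have hq : h = q * g by rewrite divpK.
have qm : q \is monic by rewrite -(monicMr q gm) -hq.
have gi : g \is a polyOver aint.
  apply: polyOver_aint_roots => // x gx.
  by apply: (aint_root_monic hm) => //; rewrite hq rootM gx orbT.
have qi : q \is a polyOver aint.
  apply: polyOver_aint_roots => // x qx.
  by apply: (aint_root_monic hm) => //; rewrite hq rootM qx.
have [rs] := closed_field_poly_normal g; rewrite (monicP gm) scale1r => grs.
have rsg r : r \in rs -> root g r by rewrite grs root_prod_XsubC.
have rsi : all [pred r | r \in aint] rs.
  by apply/allP => r /rsg gr /=; exact: (aint_root_monic gm).
have frs : all [pred r | f.[r] \in aint] rs.
  by apply/allP => r /rsg gr /=; exact: (aint_conjugate fE gmin gr).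
have [H [Q [Hi sH]]] := aint_euler rsi frs; rewrite -grs => eH.
have HE : H \is a polyOver E.
  suff -> : H = (f * g^`()) %% g.
    by rewrite polyOver_modp ?rpredM ?polyOver_deriv.
  by rewrite eH modp_addl_mul_small // [in X in (_ < X)%N]grs size_prod_XsubC.
have PF P : P \is a polyOver E -> P \is a polyOver aint ->
    P.[v] \in Frobenius_periodic p.
  move=> /polyOverP PE /polyOverP Pi.
  have PS : P \is a polyOver (Frobenius_periodic_ring C p_pr).
    by apply/polyOverP => i; exact: UE.
  exact: rpred_horner PS vF.
apply: (Frobenius_periodic_cancel p_pr pD hD) => //.
  by apply: PF; exact: polyOver_deriv.
have -> : h^`().[v] * f.[v] = (q * H).[v].
  have := congr1 (horner^~ v) eH; rewrite hq derivM !hornerE /= (rootP gv).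
  by rewrite !mulr0 !add0r => <-; ring.
by apply: PF; rewrite rpredM // polyOver_divp.
Qed.

End PolyOverSubfield.

(** * Subfields of C generated by a set *)

Section AdjoinQ.
Variable C : numClosedFieldType.
Implicit Types (S F : set C) (x y : C).

Lemma adjoinQ_subfield S : is_subfield (adjoinQ S).
Proof.
split; rewrite ?in_setE.
- by move=> F [[F1 _ _] _]; rewrite in_setE in F1.
- move=> x y; rewrite !in_setE => hx hy F FS; have [[_ FB _] _] := FS.
  by rewrite -in_setE FB // in_setE; [exact: hx | exact: hy].
- move=> x y; rewrite !in_setE => hx hy F FS; have [[_ _ FV] _] := FS.
  by rewrite -in_setE FV // in_setE; [exact: hx | exact: hy].
Qed.

Lemma sub_adjoinQ S : (S `<=` adjoinQ S)%classic.
Proof. by move=> x Sx F [_]; exact. Qed.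

Lemma adjoinQ_sub S F : is_subfield F -> (S `<=` F)%classic ->
  (adjoinQ S `<=` F)%classic.
Proof. by move=> hF SF x; apply; split. Qed.

(** Bridges subfields given as sets to the predicate structure expected by the closure lemmas. *)
Definition subfield_pred F (hF : is_subfield F) : divringClosed C :=
  HB.pack [in F] (GRing.isDivringClosed.Build C [in F] hF).

Lemma subfield_predE F (hF : is_subfield F) x : (x \in subfield_pred hF) = (x \in F).
Proof. by []. Qed.

Lemma ring_of_integersE F x : ring_of_integers F x <-> F x /\ x \in aint.
Proof. by split=> -[Fx /aintP]. Qed.

Lemma mem_subfield_pred F (hF : is_subfield F) x : F x -> x \in subfield_pred hF.
Proof. by rewrite subfield_predE in_setE. Qed.

End AdjoinQ.

Section Subfield.
Variables (C : numClosedFieldType) (F : set C).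
Hypothesis F_sub : is_subfield F.
Let E := subfield_pred F_sub.
Let toE x : F x <-> x \in E.
Proof. by rewrite subfield_predE in_setE. Qed.

Lemma subfield1 : F 1. Proof. exact/toE/rpred1. Qed.
Lemma subfield_nat n : F n%:R. Proof. exact/toE/rpred_nat. Qed.
Lemma subfield_int n : F n%:~R. Proof. exact/toE/rpred_int. Qed.
Lemma subfieldD x y : F x -> F y -> F (x + y).
Proof. by move=> /toE hx /toE hy; exact/toE/rpredD. Qed.
Lemma subfieldN x : F x -> F (- x).
Proof. by move=> /toE hx; apply/toE; rewrite rpredN. Qed.
Lemma subfieldB x y : F x -> F y -> F (x - y).
Proof. by move=> /toE hx /toE hy; exact/toE/rpredB. Qed.
Lemma subfieldM x y : F x -> F y -> F (x * y).
Proof. by move=> /toE hx /toE hy; exact/toE/rpredM. Qed.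
Lemma subfieldV x : F x -> F x^-1.
Proof. by move=> /toE hx; apply/toE; rewrite rpredV. Qed.
Lemma subfield_div x y : F x -> F y -> F (x / y).
Proof. by move=> hx hy; exact/subfieldM/subfieldV. Qed.
Lemma subfieldX x n : F x -> F (x ^+ n).
Proof. by move=> /toE hx; exact/toE/rpredX. Qed.
Lemma subfield_sum (I : finType) (f : I -> C) :
  (forall i, F (f i)) -> F (\sum_i f i).
Proof. by move=> hf; apply/toE/rpred_sum => i _; exact/toE. Qed.
Lemma subfield_ratr q : F (ratr q).
Proof. by apply: subfield_div; exact: subfield_int. Qed.

End Subfield.

(** * Imaginary-quadratic fields and the primes dividing their discriminant *)

Lemma prime_ndvd4 p : prime p -> p != 2%N -> ~~ (p %| 4)%N.
Proof. by move=> pp; rewrite (Euclid_dvdX 2 2 pp) andbT dvdn_prime2. Qed.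

(** The equations are the index formulas for Z[sqrt(-m)] and, when m = 3 modulo 4,
    Z[(1 + sqrt(-m)) / 2], of discriminants -4m and -m, and the identity behind Stickelberger's
    congruence. An odd prime dividing [m] but not [d] would divide [k], against [m] being
    squarefree. *)
Lemma quadratic_discriminant_primes (m : nat) (d k s N : int) p :
  square_free m -> prime p -> - (4 * m%:Z) = d * k ^+ 2 -> d = s ^+ 2 - 4 * N ->
  ((m %% 4 = 3)%N -> exists j, - m%:Z = d * j ^+ 2) ->
  if (p%:Z %| d)%Z then (p %| m)%N || (p == 2%N) && (m %% 4 == 1)%N
  else if p == 2%N then (m %% 4 == 3)%N else ~~ (p %| m)%N.
Proof.
move=> sf pp mk dsN m3; have [-> | p2] := eqVneq p 2%N; last first.
  have p4 : coprime p 4 by rewrite prime_coprime ?prime_ndvd4.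
  have mkn : (4 * m = `|d| * `|k| ^ 2)%N.
    by have := congr1 absz mk; rewrite abszN !abszM mulnn.
  rewrite orbF; case: ifP => /= pd.
    by rewrite -(Gauss_dvdr _ p4) mkn dvdn_mulr.
  apply/negP => pm; have : (p %| `|d| * `|k| ^ 2)%N by rewrite -mkn dvdn_mull.
  rewrite Euclid_dvdM // Euclid_dvdX // andbT; have -> : (p %| `|d|)%N = false by [].
  move=> /= pk; have p2m : (p ^ 2 %| 4 * m)%N by rewrite mkn dvdn_mull // dvdn_exp2r.
  have /sf p1 : (p ^ 2 %| m)%N by rewrite Gauss_dvdr // in p2m; rewrite coprimeXl.
  by rewrite p1 in pp.
case: ifP => d2 /=.
  (* With [d] even, m = 3 modulo 4 would make the odd number -m = d j^2 even. *)
  have [//|/= m2] := boolP (2 %| m)%N; case: (boolP (m %% 4 == 1)%N) => //= m1.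
  have [|j mj] := m3; first lia.
  by exfalso; move/dvdzP: d2 => [c dc]; rewrite dc in mj; move: mj; lia.
have m4 : ~ (4 %| m)%N by move/(sf 2).
(* Stickelberger: as [d] is odd, so is [s], whence d = 1 modulo 4. *)
have [c dc] : exists c, d = 4 * c + 1.
  have [a [sa|sa]] : exists a, s = 2 * a \/ s = 2 * a + 1.
    by exists (s %/ 2)%Z; lia.
  - exfalso; move: d2; rewrite dsN sa => /negP; case; apply/dvdzP.
    by exists (2 * a ^+ 2 - 2 * N); ring.
  - by exists (a ^+ 2 + a - N); rewrite dsN sa; ring.
(* If k = 2b with [b] even, then 4 divides [m]; with [b] odd, -m = d b^2 is 1 modulo 4; an odd [k]
   would make 4m odd. *)
have [b [kb|kb]] : exists b, k = 2 * b \/ k = 2 * b + 1.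
    by exists (k %/ 2)%Z; lia.
- rewrite kb in mk; have [e [be|be]] : exists e, b = 2 * e \/ b = 2 * e + 1.
    by exists (b %/ 2)%Z; lia.
  + exfalso; apply: m4; have : - m%:Z = 4 * (d * e ^+ 2) by rewrite be in mk; lia.
    lia.
  + have : - m%:Z = 4 * ((4 * c + 1) * (e ^+ 2 + e) + c) + 1.
      rewrite be dc in mk; lia.
    lia.
- exfalso; have : - (4 * m%:Z) = 4 * (c * k ^+ 2) + 4 * (b ^+ 2 + b) + 1.
    rewrite mk dc kb; ring.
  lia.
Qed.

Lemma det_mx22 (R : comNzRingType) (A : 'M[R]_2) :
  \det A = A 0 0 * A 1 1 - A 0 1 * A 1 0.
Proof.
rewrite (expand_det_row A 0) !big_ord_recl big_ord0 /cofactor !det_mx11 !mxE /=.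
have -> : lift ord0 (ord0 : 'I_1) = 1 by apply/val_inj.
have -> : lift 1 ord0 = 0 :> 'I_2 by apply/val_inj.
have -> : ord0 = 0 :> 'I_2 by [].
rewrite /bump /= addn0 expr0 expr1; ring.
Qed.

Section QuadraticField.
Variables (C : numClosedFieldType) (m : nat).
Hypothesis m_gt0 : (0 < m)%N.
Let r : C := sqrtC (- m%:R).
Let K : set C := quadratic_field m.

Lemma sqr_sqrtN : r ^+ 2 = - m%:R. Proof. exact: sqrtCK. Qed.

(** The conjugate is r or -r, and r is not real since its square is negative. *)
Lemma conj_sqrtN : r^* = - r.
Proof.
have : (r^*) ^+ 2 = r ^+ 2 by rewrite -rmorphXn /= sqr_sqrtN rmorphN rmorph_nat.
move/eqP; rewrite eqf_sqr => /orP[/eqP /CrealP rr|/eqP//].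
have := real_exprn_even_ge0 (n := 2) rr isT; rewrite sqr_sqrtN oppr_ge0.
by rewrite lern0 => /eqP m0; move: m_gt0; rewrite m0.
Qed.

Lemma quadratic_fieldP x :
  K x <-> exists a b : rat, x = ratr a + ratr b * r.
Proof.
pose F : set C := [set x | exists a b : rat, x = ratr a + ratr b * r]%classic.
have nz (a b : rat) : ratr a + ratr b * r != 0 :> C ->
   a ^+ 2 + m%:R * b ^+ 2 != 0.
  apply: contraNneq => /eqP; rewrite paddr_eq0 ?sqr_ge0 ?(mulr_ge0 (ler0n _ _) (sqr_ge0 _)) //.
  rewrite sqrf_eq0 mulf_eq0 sqrf_eq0 pnatr_eq0 eqn0Ngt m_gt0 /=.
  by move=> /andP[/eqP-> /eqP->]; rewrite rmorph0 mul0r addr0.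
have F_sub : is_subfield F.
  split; rewrite ?in_setE.
  - by exists 1, 0; rewrite rmorph1 rmorph0 mul0r addr0.
  - move=> x1 y1; rewrite !in_setE => -[a [b ->]] [a' [b' ->]].
    by exists (a - a'), (b - b'); rewrite !rmorphB /=; ring.
  - move=> x1 y1; rewrite !in_setE => -[a [b ->]] [a' [b' ->]].
    have [->|y0] := eqVneq (ratr a' + ratr b' * r) 0.
      by exists 0, 0; rewrite invr0 mulr0 rmorph0 mul0r addr0.
    (* The norm of the divisor: the quotient is computed by multiplying with the conjugate. *)
    pose n := a' ^+ 2 + m%:R * b' ^+ 2.
    have n0 : ratr n != 0 :> C by rewrite fmorph_eq0; exact: nz.
    exists ((a * a' + m%:R * b * b') / n), ((b * a' - a * b') / n).
    apply: (mulIf y0); rewrite divfK //.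
    apply: (mulIf n0); rewrite !(fmorph_div, rmorphD, rmorphB, rmorphM, rmorph_nat) /=.
    have en : ratr n = ratr a' ^+ 2 - r ^+ 2 * ratr b' ^+ 2 :> C.
      by rewrite sqr_sqrtN !(rmorphD, rmorphM, rmorphXn, rmorph_nat) /=; ring.
    have em : m%:R = - r ^+ 2 :> C by rewrite sqr_sqrtN opprK.
    rewrite em; move: n0; rewrite en => n0; field; by move: n0; rewrite /= -!expr2 mulNr.
split=> [|[a [b ->]]].
  apply: (adjoinQ_sub F_sub) => _ ->.
  by exists 0, 1; rewrite rmorph0 rmorph1 mul1r add0r.
have Ks := adjoinQ_subfield [set r]%classic.
apply: (subfieldD Ks); first exact: subfield_ratr.
by apply: (subfieldM Ks); [exact: subfield_ratr | exact: sub_adjoinQ].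
Qed.

Lemma quadratic_subfield : is_subfield K.
Proof. exact: adjoinQ_subfield. Qed.

Lemma quadratic_sqrtN : K r.
Proof. exact: sub_adjoinQ. Qed.

Lemma conj_ratr (a : rat) : (ratr a : C)^* = ratr a.
Proof. by rewrite fmorph_div /= !rmorph_int. Qed.

Lemma conj_quadratic (a b : rat) :
  (ratr a + ratr b * r)^* = ratr a - ratr b * r.
Proof. by rewrite rmorphD /= conj_ratr rmorphM /= conj_ratr conj_sqrtN mulrN. Qed.

Lemma quadratic_conj x : K x -> K x^*.
Proof.
move=> /quadratic_fieldP[a [b ->]]; apply/quadratic_fieldP; exists a, (- b).
by rewrite conj_quadratic rmorphN mulNr.
Qed.

Lemma quadratic_real_int x : K x -> x \in aint -> x^* = x ->
  exists z : int, x = z%:~R.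
Proof.
move=> /quadratic_fieldP[a [b ->]] xi.
rewrite conj_quadratic => /addrI.
move=> /eqP; rewrite eqNr => /eqP br; rewrite br addr0 in xi *.
have /intrP[z ->] := aint_ratr xi; by exists z; rewrite ratr_int.
Qed.

Variable d : int.
Hypothesis m_sf : square_free m.
Hypothesis hd : is_discriminant K d.

Lemma aint_sqrtN : r \in aint.
Proof. exact: aint_sqr_neg_nat sqr_sqrtN. Qed.

Lemma quadratic_half : (m %% 4 = 3)%N -> K ((1 + r) / 2) /\ (1 + r) / 2 \in aint.
Proof.
move=> m3; split.
  apply: (subfield_div quadratic_subfield).
    exact: (subfieldD quadratic_subfield (subfield1 quadratic_subfield)
      quadratic_sqrtN).
  exact: (subfield_nat quadratic_subfield).
have [k mk] : exists k, m = (4 * k + 3)%N by exists (m %/ 4)%N; lia.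
(* The polynomial is X^2 - X + (m + 1) / 4. *)
apply: (@aint_root_monic _ (('X - 1%:P) * 'X + (k.+1%:R)%:P)).
- rewrite monicE lead_coefDl; first by rewrite lead_coefM lead_coefXsubC lead_coefX mulr1.
  by rewrite size_polyC size_mulX ?polyXsubC_eq0 // size_XsubC; case: eqP.
- by rewrite rpredD ?rpredM ?polyOverC ?polyOverXsubC ?polyOverX ?rpred1 ?rpred_nat.
- have -> : k.+1%:R = (1 - r ^+ 2) / 4 :> C.
    by rewrite sqr_sqrtN mk -natr1 natrD natrM; field.
  by rewrite rootE hornerD hornerM hornerXsubC hornerX hornerC; apply/eqP; field.
Qed.

(** For integers x, y of K, the determinant formed by x, y and their conjugates has square [d] times
    the square of an integer. The pairs (1, r) and (1, (1 + r) / 2) give the index formulas. *)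
Lemma discriminant_primes p : prime p ->
  if (p%:Z %| d)%Z then (p %| m)%N || (p == 2%N) && (m %% 4 == 1)%N
  else if p == 2%N then (m %% 4 == 3)%N else ~~ (p %| m)%N.
Proof.
move=> pp; have [w [wO wspan _]] := hd; rewrite det_mx22 !mxE /= => dw.
have [/ring_of_integersE[K0 i0] /ring_of_integersE[K1 i1]] := (wO 0, wO 1).
have pair x y : K x -> K y -> x \in aint -> y \in aint ->
    exists k : int, (x * y^* - y * x^*) ^+ 2 = d%:~R * k%:~R ^+ 2 :> C.
  move=> Kx Ky xi yi.
  have [|a ->] := wspan x; first exact/ring_of_integersE.
  have [|b ->] := wspan y; first exact/ring_of_integersE.
  exists (a 0 * b 1 - a 1 * b 0).
  rewrite intrB !intrM dw !big_ord_recl !big_ord0 /= !addr0 !rmorphD !rmorphM /= !rmorph_int.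
  have -> : lift ord0 (ord0 : 'I_1) = 1 by apply/val_inj.
  ring.
have [k hk] := pair 1 r (subfield1 quadratic_subfield) quadratic_sqrtN
  (rpred1 _) aint_sqrtN.
(* The square of a difference is the square of the sum [s] minus four times the product [N], so d =
   s^2 - 4 N. *)
have [N hN] : exists N : int, w 0 * (w 0)^* * (w 1 * (w 1)^*) = N%:~R.
  apply: quadratic_real_int.
  - by do !apply: (subfieldM quadratic_subfield) => //; exact: quadratic_conj.
  - by rewrite !rpredM ?aint_conj.
  - by rewrite !rmorphM /= !conjCK; ring.
have [s hs] : exists s : int, w 0 * (w 1)^* + w 1 * (w 0)^* = s%:~R.
  apply: quadratic_real_int.
  - by apply: (subfieldD quadratic_subfield);
      apply: (subfieldM quadratic_subfield) => //; exact: quadratic_conj.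
  - by rewrite !(rpredD, rpredM) ?aint_conj.
  - by rewrite rmorphD !rmorphM /= !conjCK; ring.
apply: (@quadratic_discriminant_primes m d k s N) => //.
- apply: (@intr_inj C); rewrite intrM rmorphXn /= -hk rmorph1 conj_sqrtN.
  rewrite rmorphN rmorphM /= mulr1 mul1r -[m%:~R]opprK -sqr_sqrtN; ring.
- apply: (@intr_inj C).
  by rewrite intrB intrM rmorphXn /= dw -hN -hs; ring.
move=> m3; have [j hj] : exists k : int, r ^+ 2 = d%:~R * k%:~R ^+ 2.
  have [Kw wi] := quadratic_half m3.
  have [//|j hj] := pair 1 _ (subfield1 quadratic_subfield) Kw (rpred1 _).
  exists j; rewrite -hj fmorph_div rmorph1 rmorphD rmorph1 rmorph_nat /= conj_sqrtN.
  by field.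
exists j; apply: (@intr_inj C); rewrite intrM rmorphXn /= -hj sqr_sqrtN.
by rewrite rmorphN.
Qed.

(** The order Z[s] has discriminant [D] prime to [p]: [s] is (1 + r) / 2 with D = -m for p = 2, and
    r with D = -4m for odd p. *)
Lemma quadratic_generator p : prime p -> ~~ (p%:Z %| d)%Z ->
  exists s (D : int), [/\ K s, s \in Frobenius_periodic p,
    (s - s^*) ^+ 2 = D%:~R & ~~ (p%:Z %| D)%Z].
Proof.
move=> pp pd; have := discriminant_primes pp; rewrite (negbTE pd).
have [-> /eqP m3 | p2 pm] := eqVneq p 2%N.
  have [Kw wi] := quadratic_half m3; exists ((1 + r) / 2), (- m%:Z).
  have [k mk] : exists k, m = (4 * k + 3)%N by exists (m %/ 4)%N; lia.
  have [t kt] : exists t, (k * k.+1 = 2 * t)%N.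
    by exists (k * k.+1)./2; rewrite mul2n even_halfK // oddM /= andbN.
  split=> //.
  - apply/Frobenius_periodicP; split=> //; exists 2 => //.
    (* For w = (1 + r) / 2, w^2 = w - (k + 1) gives w^4 - w = k (k + 1) - 2 (k + 1) w, and k (k + 1)
       = 2 t. *)
    have -> : ((1 + r) / 2) ^+ (2 ^ 2) - (1 + r) / 2
        = 2%:R * (t%:R - k.+1%:R * ((1 + r) / 2)).
      have ek : k.+1%:R = (1 - r ^+ 2) / 4 :> C.
        by rewrite sqr_sqrtN mk -natr1 natrD natrM; field.
      rewrite mulrBr -natrM -kt natrM -[k%:R](addrK 1) natr1 ek.
      by rewrite (_ : (2 ^ 2 = 4)%N) //; field.
    apply: aint_mul_nat => //.
    by apply: rpredB; rewrite ?rpred_nat //; apply: rpredM; rewrite ?rpred_nat.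
  - rewrite rmorphN /= -[m%:~R]opprK -sqr_sqrtN fmorph_div rmorphD rmorph1.
    by rewrite rmorph_nat /= conj_sqrtN; field.
  - by rewrite dvdzE abszN /=; lia.
exists r, (- (4 * m%:Z)); split.
- exact: quadratic_sqrtN.
- apply: (@Frobenius_periodic_unity _ _ pp _ (4 * p.-1)) => //.
  + by have := prime_gt1 pp; lia.
  + rewrite Euclid_dvdM // negb_or prime_ndvd4 //=; apply/negP.
    by have := prime_gt1 pp => p1 /dvdn_leq; lia.
  + exact: aint_sqrtN.
  + have -> : r ^+ (4 * p.-1) = ((m ^ 2) ^ p.-1)%:R.
      by rewrite (exprM _ 4) (exprM _ 2 2) sqr_sqrtN sqrrN -!natrX.
    have h : (p %| (m ^ 2) ^ p.-1 - 1)%N.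
      rewrite -eqn_mod_dvd ?expn_gt0 ?m_gt0 //; apply/eqP.
      rewrite -[p.-1]totient_prime //; apply: Euler_exp_totient.
      by rewrite coprime_sym coprimeXr // prime_coprime.
    rewrite -[1]/(1%:R) -natrB ?expn_gt0 ?m_gt0 // -[_%:R]/((_%:Z)%:~R).
    by rewrite aint_mul_int ?prime_gt0.
- rewrite conj_sqrtN opprK rmorphN rmorphM /= -[m%:~R]opprK -sqr_sqrtN.
  by ring.
- rewrite dvdzE abszN abszM /= Euclid_dvdM // negb_or pm andbT.
  exact: prime_ndvd4.
Qed.

(** Integers of K are combinations of 1 and [s] up to the factor [D]: D x = w s + u with rational
    integers w, u, obtained as integers of K fixed by conjugation. *)
Lemma quadratic_Frobenius_periodic p x : prime p -> ~~ (p%:Z %| d)%Z ->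
  K x -> x \in aint -> x \in Frobenius_periodic p.
Proof.
move=> pp pd Kx xi; have [s [D [Ks sF sD pD]]] := quadratic_generator pp pd.
have si := Frobenius_periodic_aint sF.
have Kmul := subfieldM quadratic_subfield; have Ksub := subfieldB quadratic_subfield.
have [w hw] : exists w : int, (x - x^*) * (s - s^*) = w%:~R.
  apply: quadratic_real_int.
  - by apply: (Kmul); apply: (Ksub) => //; exact: quadratic_conj.
  - by rewrite rpredM ?rpredB ?aint_conj.
  - by rewrite rmorphM !rmorphB /= !conjCK; ring.
have [u hu] : exists u : int, D%:~R * x - w%:~R * s = u%:~R.
  apply: quadratic_real_int.
  - by apply: (Ksub); apply: (Kmul) => //; exact: subfield_int quadratic_subfield _.
  - by rewrite rpredB ?rpredM ?rpred_int.
  - rewrite rmorphB !rmorphM /= !rmorph_int -sD -hw; ring.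
apply: (Frobenius_periodic_cancel_int pp pD) => //.
rewrite -[_ * x](subrK (w%:~R * s)) hu.
apply: Frobenius_periodicD => //; first exact: Frobenius_periodic_int.
by apply: Frobenius_periodicM => //; exact: Frobenius_periodic_int.
Qed.

End QuadraticField.

(** * Ideals of rings of integers and ramification criteria *)

Section Ideals.
Local Open Scope classical_set_scope.
Local Open Scope ring_scope.
Variables (C : numClosedFieldType) (F : set C).
Hypothesis F_sub : is_subfield F.
Let O := ring_of_integers F.
Implicit Types (I J S P : set C) (x y : C).

Lemma integers_sub x : O x -> F x. Proof. by case. Qed.

Lemma integers_aint x : O x -> x \in aint.
Proof. by move/ring_of_integersE => []. Qed.

Lemma integersP x : F x -> x \in aint -> O x.
Proof. by move=> Fx xi; apply/ring_of_integersE. Qed.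

Lemma integers_int (z : int) : O z%:~R.
Proof. by apply: integersP; [exact: subfield_int | exact: rpred_int]. Qed.

Lemma integers_nat n : O n%:R.
Proof. exact: (integers_int n). Qed.

Lemma integersD x y : O x -> O y -> O (x + y).
Proof.
move=> /ring_of_integersE[Fx xi] /ring_of_integersE[Fy yi].
by apply: integersP; [exact: subfieldD | exact: rpredD].
Qed.

Lemma integersM x y : O x -> O y -> O (x * y).
Proof.
move=> /ring_of_integersE[Fx xi] /ring_of_integersE[Fy yi].
by apply: integersP; [exact: subfieldM | exact: rpredM].
Qed.

Lemma integersN x : O x -> O (- x).
Proof.
move=> Ox; rewrite -mulN1r; apply: integersM => //.
exact: (integers_int (-1)).
Qed.

Lemma integersB x y : O x -> O y -> O (x - y).
Proof. by move=> Ox Oy; apply: integersD => //; exact: integersN. Qed.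

Lemma integersX x n : O x -> O (x ^+ n).
Proof.
move=> Ox; elim: n => [|n IHn]; first exact: (integers_nat 1).
by rewrite exprS; exact: integersM.
Qed.

Lemma integers_ideal : is_ideal O O.
Proof.
split=> // [|x y|a x]; [exact: (integers_nat 0) | exact: integersD | exact: integersM].
Qed.

Lemma ideal_gen_ideal S : S `<=` O -> is_ideal O (ideal_gen O S).
Proof.
move=> SO; split.
- by move=> x; apply; split => //; exact: integers_ideal.
- by move=> I [[]].
- move=> x y hx hy I IS; have [[_ _ ID _] _] := IS.
  by apply: ID; [exact: hx | exact: hy].
- move=> a x Oa hx I IS; have [[_ _ _ IM] _] := IS.
  by apply: IM => //; exact: hx.
Qed.

Lemma ideal_gen_sub S I : is_ideal O I -> S `<=` I -> ideal_gen O S `<=` I.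
Proof. by move=> hI SI x; apply; split. Qed.

Lemma sub_ideal_gen S : S `<=` ideal_gen O S.
Proof. by move=> x Sx I [_]; exact. Qed.

Lemma principal_ideal x :
  O x -> is_ideal O [set y | exists2 a, O a & y = x * a].
Proof.
move=> Ox; split.
- by move=> _ [a Oa ->]; exact: integersM.
- by exists 0; rewrite ?mulr0 //; exact: (integers_nat 0).
- move=> _ _ [a Oa ->] [b Ob ->]; exists (a + b); rewrite ?mulrDr //.
  exact: integersD.
- by move=> b _ Ob [a Oa ->]; exists (b * a); [exact: integersM | rewrite mulrCA].
Qed.

Lemma ideal_gen1P x y : O x -> ideal_gen O [set x] y -> exists2 a, O a & y = x * a.
Proof.
move=> Ox; apply: (ideal_gen_sub (principal_ideal Ox)) => _ ->.
by exists 1; [exact: (integers_nat 1) | rewrite mulr1].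
Qed.

Lemma ideal_mul_ideal I J : is_ideal O I -> is_ideal O J ->
  is_ideal O (ideal_mul O I J).
Proof.
move=> [IO _ _ _] [JO _ _ _]; apply: ideal_gen_ideal => _ [a Ia [b Jb ->]].
by apply: integersM; [exact: IO | exact: JO].
Qed.

Lemma ideal_mul_sub I J : is_ideal O I -> J `<=` O -> ideal_mul O I J `<=` I.
Proof.
move=> hI JO; apply: ideal_gen_sub => // _ [a Ia [b Jb ->]].
by have [_ _ _ IM] := hI; rewrite mulrC; apply: IM => //; exact: JO.
Qed.

Lemma ideal_exp_ideal I k : is_ideal O I -> is_ideal O (ideal_exp O I k).
Proof.
move=> hI; elim: k => [|k IHk]; first exact: integers_ideal.
exact: ideal_mul_ideal.
Qed.

Lemma ideal_expX I k x : I x -> ideal_exp O I k (x ^+ k).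
Proof.
move=> Ix; elim: k => [|k IHk]; first exact: (integers_nat 1).
by apply: sub_ideal_gen; exists x => //; exists (x ^+ k) => //; rewrite exprS.
Qed.

Lemma ideal_exp2M I x y : I x -> I y -> ideal_exp O I 2 (x * y).
Proof.
move=> Ix Iy; apply: sub_ideal_gen; exists x => //; exists y => //.
apply: sub_ideal_gen; exists y => //; exists 1; last by rewrite mulr1.
exact: (integers_nat 1).
Qed.

Lemma prime_idealX P x k : is_prime_ideal O P -> O x -> P (x ^+ k) -> P x.
Proof.
move=> [_ P1 PM] Ox; elim: k => [|k IHk]; first by rewrite expr0.
by rewrite exprS => /(PM _ _ Ox (integersX k Ox))[].
Qed.

(* The hypothesis makes x (x^(q-1) - 1) a multiple of p for some power q > 1 of
   p, so P is generated by p after localization at P, and p in P^2 would make p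
   a unit there. *)
Lemma Frobenius_periodic_unramified p : prime p ->
  (forall x, F x -> x \in aint -> x \in Frobenius_periodic p) ->
  ~ ramified_at F p.
Proof.
move=> pp FF [P]; rewrite -/O => hP p2; have [hPI P1 PM] := hP.
have [PO P0 PD PMl] := hPI.
have PpP : P p%:R.
  have : ideal_exp O P 2 p%:R by apply: p2; exact: sub_ideal_gen.
  apply: ideal_mul_sub => //; apply: ideal_gen_sub; first exact: integers_ideal.
  by move=> _ [a Pa [b Ob ->]]; apply: integersM => //; exact: PO.
have p0 : p%:R != 0 :> C by rewrite pnatr_eq0 -lt0n prime_gt0.
pose s_ x s c := [/\ O s, ~ P s, O c & s * x = p%:R * c].
have loc x : P x -> exists s c, s_ x s c.
  move=> Px; have Ox := PO _ Px.
  have /Frobenius_periodicP[xi [f f0 /= hx]] :=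
    FF x (integers_sub Ox) (integers_aint Ox).
  have q0 : (0 < (p ^ f).-1)%N by have := ltn_exp2l 0 f (prime_gt1 pp); lia.
  (* The multiplier x^(q-1) - 1, q = p^f, is outside [P] because [x] is in [P] and 1 is not. *)
  exists (x ^+ (p ^ f).-1 - 1), ((x ^+ (p ^ f) - x) / p%:R); split.
  - by apply: integersB; [exact: integersX | exact: (integers_nat 1)].
  - move=> Ps; apply: P1; rewrite -[1](subKr (x ^+ (p ^ f).-1)) -mulN1r addrC.
    apply: PD; first by apply: PMl => //; exact: (integers_int (-1)).
    rewrite -(prednK q0) exprSr; apply: PMl => //; exact: integersX.
  - by apply: integersP => //; apply: subfield_div => //;
      [apply: subfieldB => //; [apply: subfieldX => //|] | exact: subfield_nat];
      exact: integers_sub.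
  - rewrite [RHS]mulrC divfK // mulrBl mul1r -exprSr prednK //.
    by rewrite expn_gt0 prime_gt0.
(* The integers divisible by p^2 after localization at [P]: an ideal containing P^2, and p in it
   would force s = c p into [P]. *)
pose Z : set C := [set x | O x /\ exists s c,
  [/\ O s, ~ P s, O c & s * x = p%:R ^+ 2 * c]].
have hZ : is_ideal O Z.
  split.
  - by move=> x [].
  - split; first exact: (integers_nat 0).
    exists 1, 0; rewrite !mulr0; split=> //; last exact: (integers_nat 0).
    exact: (integers_nat 1).
  - move=> x y [Ox [s [c [Os Ps Oc e]]]] [Oy [t [b [Ot Pt Ob e']]]].
    split; first exact: integersD.
    exists (s * t), (t * c + s * b); split; first exact: integersM.
    + by move=> /(PM _ _ Os Ot)[].
    + by apply: integersD; exact: integersM.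
    + by transitivity (t * (s * x) + s * (t * y)); [ring | rewrite e e'; ring].
  - move=> a x Oa [Ox [s [c [Os Ps Oc e]]]]; split; first exact: integersM.
    by exists s, (a * c); split => //; [exact: integersM | rewrite mulrCA e; ring].
have : Z p%:R.
  have : ideal_exp O P 2 p%:R by apply: p2; exact: sub_ideal_gen.
  apply: ideal_gen_sub => // _ [a Pa [b Jb ->]].
  have Pb : P b by move: Jb; exact: ideal_mul_sub.
  split; first by apply: integersM; exact: PO.
  have [s [c [Os Ps Oc e]]] := loc a Pa.
  have [t [b' [Ot Pt Ob' e']]] := loc b Pb.
  exists (s * t), (c * b'); split; try exact: integersM.
    by move=> /(PM _ _ Os Ot)[].
  by rewrite mulrACA e e'; ring.
move=> [_ [s [c [Os Ps Oc e]]]]; apply: Ps.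
have -> : s = c * p%:R by apply: (mulIf p0); rewrite e; ring.
exact: PMl.
Qed.

(** By Zorn's lemma there is a maximal ideal containing [p] but not 1; maximality makes it prime. *)
Lemma exists_prime_ideal p : prime p -> exists2 P, is_prime_ideal O P & P p%:R.
Proof.
move=> pp; have p0 : p%:R != 0 :> C by rewrite pnatr_eq0 -lt0n prime_gt0.
pose proper I := [/\ is_ideal O I, I p%:R & ~ I 1].
have prp : proper [set x | exists2 y, O y & x = p%:R * y].
  split; first exact: principal_ideal (integers_nat p).
  - by exists 1; rewrite ?mulr1 //; exact: (integers_nat 1).
  - move=> [y /integers_aint yi e].
    have : (1%:~R / p%:~R : C) \in aint.
      by rewrite -[p%:~R]/(p%:R) -[1%:~R]/1 [X in X / _]e mulrC mulKf.
    have pz : p%:Z != 0 by have := prime_gt0 pp; lia.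
    move=> /(aint_intdiv pz); rewrite dvdz1 /= => /eqP p1.
    by have := prime_gt1 pp; lia.
have [|A [hA Amax]] := @Zorn_bigcup C [set I | I = set0 \/ proper I].
  move=> G GP Gtot; have [[I0 GI0 pI0]|noI] := pselect (exists2 I, G I & proper I).
    right; have Gp I x : G I -> I x -> proper I.
      by move=> /GP[->|].
    split; [split| |].
    - by move=> x [I GI Ix]; have [[IO _ _ _] _ _] := Gp _ _ GI Ix; exact: IO.
    - by exists I0 => //; case: pI0 => -[].
    - move=> x y [I GI Ix] [J GJ Jy].
      have [IJ|JI] := Gtot _ _ GI GJ.
        exists J => //; have [[_ _ D _] _ _] := Gp _ _ GJ Jy.
        by apply: D => //; exact: IJ.
      exists I => //; have [[_ _ D _] _ _] := Gp _ _ GI Ix.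
      by apply: D => //; exact: JI.
    - move=> a x Oa [I GI Ix]; exists I => //.
      by have [[_ _ _ M] _ _] := Gp _ _ GI Ix; exact: M.
    - by exists I0 => //; case: pI0.
    - by move=> [I GI I1]; have [_ _] := Gp _ _ GI I1.
  left; apply/seteqP; split=> // x [I GI Ix]; case: (GP I GI) => [I0|pI].
    by rewrite I0 in Ix.
  by exfalso; apply: noI; exists I.
have pA : proper A.
  case: hA => // A0; exfalso; apply: Amax (or_intror prp).
  by rewrite A0; split=> // /(_ p%:R); apply; case: prp.
exists A; last by case: pA.
have [hAI Ap A1] := pA; have [AO A00 AD AM] := hAI.
have ext x : O x -> ~ A x -> exists2 a, A a & exists2 y, O y & 1 = a + x * y.
  move=> Ox Ax; apply: contrapT => no1.
  pose B : set C := [set z | exists2 a, A a & exists2 y, O y & z = a + x * y].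
  have AB : A `<=` B.
    move=> a Aa; exists a => //; exists 0; rewrite ?mulr0 ?addr0 //.
    exact: (integers_nat 0).
  apply: (Amax B).
    split=> // BA; apply: Ax; apply: BA; exists 0 => //; exists 1.
      exact: (integers_nat 1).
    by rewrite mulr1 add0r.
  right; split; [split| exact: AB|exact: no1].
  - move=> _ [a Aa [y Oy ->]]; apply: integersD; first exact: AO.
    exact: integersM.
  - exact: AB.
  - move=> _ _ [a Aa [y Oy ->]] [b Ab [z Oz ->]]; exists (a + b); first exact: AD.
    by exists (y + z); [exact: integersD | ring].
  - move=> c _ Oc [a Aa [y Oy ->]]; exists (c * a); first exact: AM.
    by exists (c * y); [exact: integersM | ring].
split=> // x y Ox Oy Axy; apply: contrapT => /not_orP[Ax Ay].
have [a Aa [u Ou ea]] := ext x Ox Ax; have [b Ab [v Ov eb]] := ext y Oy Ay.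
(* The expansion of 1 = (a + x u) (b + y v). *)
apply: A1; have -> : 1 = b * a + ((x * u) * b + ((y * v) * a + (u * v) * (x * y))).
  by rewrite -[LHS]mulr1 {1}ea eb; ring.
apply: (AD); first by apply: (AM) => //; exact: AO.
apply: (AD); first by apply: (AM) => //; exact: integersM.
apply: (AD); first by apply: (AM) => //; exact: integersM.
by apply: (AM) => //; exact: integersM.
Qed.

Lemma ramified_atP p : prime p ->
  (forall P, is_prime_ideal O P -> P p%:R -> ideal_exp O P 2 p%:R) ->
  ramified_at F p.
Proof.
move=> pp h; have [P hP Pp] := exists_prime_ideal pp; exists P => //.
apply: ideal_gen_sub; last by move=> _ ->; exact: h.
by apply: ideal_exp_ideal; case: hP.
Qed.

(** [P] contains r since r^2 = -m. With m = c p and a p + b c = 1, p = a p^2 - b r^2 is in P^2. *)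
Lemma ramified_sqrtN p (m : nat) r : prime p -> (p %| m)%N -> ~~ (p ^ 2 %| m)%N ->
  F r -> r ^+ 2 = - m%:R -> ramified_at F p.
Proof.
move=> pp pm p2m Fr r2; apply: ramified_atP => // P hP Pp.
have [hPI _ _] := hP; have [PO _ _ PM] := hPI.
have Or : O r by exact: integersP Fr (aint_sqr_neg_nat r2).
have Pr : P r.
  apply: (prime_idealX (k := 2)) => //; rewrite r2.
  have /dvdnP[c ->] := pm; rewrite natrM -mulNr; apply: PM => //.
  by apply: integersN; exact: integers_nat.
have [_ _ D2 M2] := ideal_exp_ideal 2 hPI.
have /dvdnP[c mc] := pm.
have /coprimezP[[a b] /= ab1] : coprimez p c.
  rewrite coprimezE prime_coprime //=; apply: contra p2m => /dvdnP[e ce].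
  by rewrite mc ce -mulnA mulnn dvdn_mull.
have -> : p%:R = a%:~R * (p%:R * p%:R) + (- b%:~R) * (r * r) :> C.
  rewrite -[r * r]expr2 r2 mc natrM.
  transitivity ((a * p + b * c)%:~R * p%:R : C); first by rewrite ab1 mul1r.
  by rewrite intrD !intrM; ring.
apply: (D2); apply: (M2); try exact: ideal_exp2M; first exact: integers_int.
by apply: integersN; exact: integers_int.
Qed.

(** For m = 4k + 1, (1 + r)^2 = 2 (r - 2k) puts 1 + r in [P], and -r (1 + r)^2 = 2 + 4k (2 + r). *)
Lemma ramified2_sqrtN (m : nat) r : (m %% 4 = 1)%N ->
  F r -> r ^+ 2 = - m%:R -> ramified_at F 2.
Proof.
move=> m4 Fr r2; apply: ramified_atP => // P hP Pp.
have [hPI _ _] := hP; have [PO _ PD PM] := hPI.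
have Or : O r by exact: integersP Fr (aint_sqr_neg_nat r2).
have [k mk] : exists k, m = (4 * k + 1)%N by exists (m %/ 4)%N; lia.
have Or1 : O (1 + r) by apply: integersD => //; exact: (integers_nat 1).
have Pr : P (1 + r).
  apply: (prime_idealX (k := 2)) => //.
  have -> : (1 + r) ^+ 2 = (r - 2%:R * k%:R) * 2%:R.
    transitivity (1 + r ^+ 2 + 2%:R * r); first by ring.
    by rewrite r2 mk natrD natrM; ring.
  apply: PM => //; apply: integersB => //.
  by apply: integersM; exact: integers_nat.
have [_ _ D2 M2] := ideal_exp_ideal 2 hPI.
have -> : 2%:R = (- (2%:R * k%:R) - r * k%:R) * (2%:R * 2%:R)
    + (- r) * ((1 + r) * (1 + r)) :> C.
  have -> : - r * ((1 + r) * (1 + r)) = - r - r ^+ 2 * 2 - r * r ^+ 2 by ring.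
  by rewrite r2 mk natrD natrM; ring.
apply: (D2); apply: (M2); try exact: ideal_exp2M; last exact: integersN.
apply: integersB; first apply: integersN; apply: integersM => //; exact: integers_nat.
Qed.

(** From (1 + i)^2 = 2i, 1 + i is in [P] and 2 = -i (1 + i)^2. *)
Lemma ramified2_imaginary : F 'i -> ramified_at F 2.
Proof.
move=> Fi; apply: ramified_atP => // P hP Pp.
have [hPI _ _] := hP; have [PO _ PD PM] := hPI.
have Oi : O 'i by exact: integersP Fi (@aint_sqr_neg_nat _ _ 1 (sqrCi C)).
have Oi1 : O (1 + 'i) by apply: integersD => //; exact: (integers_nat 1).
have Pi1 : P (1 + 'i).
  apply: (prime_idealX (k := 2)) => //.
  have -> : (1 + 'i) ^+ 2 = 'i * 2%:R :> C.
    by transitivity (1 + 'i ^+ 2 + 'i * 2 : C); [ring | rewrite sqrCi; ring].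
  exact: PM.
have [_ _ D2 M2] := ideal_exp_ideal 2 hPI.
have -> : 2%:R = (- 'i) * ((1 + 'i) * (1 + 'i)) :> C.
  transitivity (- 'i - 'i ^+ 2 * 2 - 'i * 'i ^+ 2 : C); last by ring.
  by rewrite sqrCi; ring.
by apply: M2; [exact: integersN | exact: ideal_exp2M].
Qed.

(** As the powers of z sum to 0, p is the sum of the 1 - z^i, that is 1 - z times the sum of the
    [t i]. Modulo 1 - z, [t i] is i, so the second factor is congruent to p (p - 1) / 2, a multiple
    of the odd p; both factors lie in [P]. *)
Lemma ramified_unity_root p z : prime p -> p != 2%N ->
  F z -> z ^+ p = 1 -> z != 1 -> ramified_at F p.
Proof.
move=> pp p2 Fz zp z1; apply: ramified_atP => // P hP Pp.
have [hPI _ _] := hP; have [PO P0 PD PM] := hPI.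
have p_odd : odd p by case: (even_prime pp) => // e; rewrite e in p2.
have Oz : O z.
  apply: integersP => //; apply: (@aint_root_monic _ ('X^p - 1%:P)).
  - by rewrite monicXnsubC // prime_gt0.
  - by rewrite polyOverXnsubC rpred1.
  - by rewrite rootE !hornerE zp subrr.
have O1 : O 1 := integers_nat 1.
have Oz1 : O (1 - z) by exact: integersB.
have Pz1 : P (1 - z).
  apply: (prime_idealX (k := p)) => //.
  (* Modulo p, (1 - z)^p is 1 - z^p = 0. *)
  have := aint_mul_FrobeniusD 1 pp (rpred1 _) (rpredNr (integers_aint Oz)).
  rewrite expn1 exprNn zp expr1n -signr_odd p_odd expr1 mulN1r subrr subr0.
  rewrite aint_mulE => zi.
  rewrite -[_ ^+ p](divfK (_ : p%:R != 0 :> C)) ?pnatr_eq0 -?lt0n ?prime_gt0 //.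
  apply: PM => //; apply: integersP => //.
  apply: subfield_div => //; last exact: subfield_nat.
  by apply: subfieldX => //; exact: integers_sub.
have Psum (I : finType) (f : I -> C) : (forall i, P (f i)) -> P (\sum_i f i).
  by move=> hf; apply: (big_ind P).
have Osum (I : finType) (f : I -> C) : (forall i, O (f i)) -> O (\sum_i f i).
  by move=> hf; apply: (big_ind O) => //; [exact: (integers_nat 0) | exact: integersD].
pose t i := \sum_(j < i) z ^+ j.
have tE i : 1 - z ^+ i = (1 - z) * t i.
  by rewrite -[1 in LHS](expr1n _ i) subrXX; congr (_ * _); apply: eq_bigr => j _;
    rewrite expr1n mul1r.
have sz : \sum_(i < p) z ^+ i = 0.
  apply: (mulfI (_ : 1 - z != 0)); first by rewrite subr_eq0 eq_sym.
  by rewrite -/(t p) -tE zp subrr mulr0.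
have -> : p%:R = (1 - z) * \sum_(i < p) t i :> C.
  rewrite mulr_sumr; under eq_bigr do rewrite -tE.
  by rewrite sumrB sz subr0 sumr_const card_ord.
apply: ideal_exp2M => //.
have -> : \sum_(i < p) t i = \sum_(i < p) (t i - i%:R) + ('C(p, 2))%:R.
  by rewrite sumrB -natr_sum -(big_mkord xpredT id) bin2_sum subrK.
apply: PD.
  apply: (Psum) => i; rewrite /t.
  have -> : i%:R = \sum_(j < i) 1 :> C by rewrite sumr_const card_ord.
  rewrite -sumrB; apply: (Psum) => j.
  have -> : z ^+ j - 1 = (- t j) * (1 - z) by rewrite mulNr mulrC -tE opprB.
  apply: PM => //; apply: integersN; apply: (Osum) => k; exact: integersX.
have /dvdnP[c ->] : (p %| 'C(p, 2))%N.
  by apply: prime_dvd_bin => //; have := prime_gt1 pp; move: p2; lia.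
by rewrite natrM; apply: PM => //; exact: integers_nat.
Qed.

End Ideals.

(** * Adjunction of n-th roots that are units modulo p *)

Lemma prime_ndvdzX p (N : int) k :
  prime p -> ~~ (p%:Z %| N)%Z -> ~~ (p%:Z %| N ^+ k)%Z.
Proof.
move=> pp; apply: contra; rewrite !dvdzE abszX Euclid_dvdX //.
by case/andP.
Qed.

Section KummerTower.
Local Open Scope classical_set_scope.
Local Open Scope ring_scope.
Variables (C : numClosedFieldType) (K : set C) (n p : nat).
Hypotheses (K_sub : is_subfield K) (p_pr : prime p) (pn : ~~ (p %| n)%N).
Hypothesis K_Frob : forall x, K x -> x \in aint -> x \in Frobenius_periodic p.

(** The last condition says that [v] is invertible modulo [p], with its conjugate as integral
    cofactor. *)
Definition coprime_radical (v : C) : Prop := [/\ K (v ^+ n), v \in aint &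
  exists2 N : int, v * v^* = N%:~R & ~~ (p%:Z %| N)%Z].

Let n_gt0 : (0 < n)%N.
Proof. by case: n pn => //; rewrite dvdn0. Qed.

(** Let a = v^n and a^q = a modulo p. Multiplying by the n-th power of the conjugate of [v] gives
    N^n (v^(n (q - 1)) - 1) = 0 modulo p, and n (q - 1) is prime to p. *)
Lemma coprime_radical_periodic v : coprime_radical v -> v \in Frobenius_periodic p.
Proof.
move=> [Kvn vi [N vN pN]].
have ai := rpredX n vi.
have /Frobenius_periodicP[_ [f f0 hf]] := K_Frob Kvn ai.
have pf0 : (0 < p ^ f)%N by rewrite expn_gt0 prime_gt0.
have q0 : (0 < (p ^ f).-1)%N by have := ltn_exp2l 0 f (prime_gt1 p_pr); lia.
apply: (@Frobenius_periodic_unity _ _ p_pr v (n * (p ^ f).-1)) => //.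
- by rewrite muln_gt0 n_gt0.
- rewrite Euclid_dvdM // negb_or pn /=; apply/negP => h.
  have : (p %| p ^ f)%N by apply: dvdn_exp.
  rewrite -(prednK pf0).
  by rewrite -addn1 dvdn_addr // dvdn1 => /eqP p1; have := prime_gt1 p_pr; lia.
apply: (@aint_mul_cancel _ p (N ^+ n)) => //.
- exact: prime_ndvdzX.
- by rewrite rpredB ?rpred1 ?rpredX.
have -> : (N ^+ n)%:~R * (v ^+ (n * (p ^ f).-1) - 1)
    = (v^* ^+ n) * ((v ^+ n) ^+ (p ^ f) - v ^+ n).
  rewrite rmorphXn /= -vN exprMn exprM -[in RHS](prednK pf0).
  by rewrite [(v ^+ n) ^+ _.+1]exprS; ring.
by rewrite aint_mulMl // rpredX // aint_conj.
Qed.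

Definition adjoin_seq (s : seq C) : set C := adjoinQ (K `|` [set` s]).

Lemma adjoin_seqS s t : {subset s <= t} -> adjoin_seq s `<=` adjoin_seq t.
Proof.
move=> st; apply: adjoinQ_sub; first exact: adjoinQ_subfield.
move=> x [Kx|/= /st xt]; apply: sub_adjoinQ; by [left | right].
Qed.

Lemma adjoin_seq_periodic s : {in s, forall v, coprime_radical v} ->
  forall x, adjoin_seq s x -> x \in aint -> x \in Frobenius_periodic p.
Proof.
elim: s => [|v s IHs] hs x.
  move=> hx; apply: K_Frob; move: hx; apply: adjoinQ_sub => // y [//|].
  by rewrite /= in_nil.
have Es := adjoinQ_subfield (K `|` [set` s]).
have /IHs {}IHs : {in s, forall w, coprime_radical w}.
  by move=> w ws; apply: hs; rewrite in_cons ws orbT.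
have hv : coprime_radical v by apply: hs; rewrite mem_head.
have [Kvn vi [N vN pN]] := hv.
have Evn : v ^+ n \in subfield_pred Es.
  by apply: mem_subfield_pred; apply: sub_adjoinQ; left.
have hE : 'X^n - (v ^+ n)%:P \is a polyOver (subfield_pred Es).
  by rewrite polyOverXnsubC.
have hm : 'X^n - (v ^+ n)%:P \is monic by rewrite monicXnsubC.
have hr : root ('X^n - (v ^+ n)%:P) v by rewrite rootE !hornerE subrr.
(* For h = X^n - v^n, h'(v) times the (n-1)-st power of the conjugate of [v] is n N^(n-1). *)
move=> xs; apply: (@Frobenius_periodic_adjoin _ (subfield_pred Es) p p_pr v _
   (v^* ^+ n.-1) (n%:Z * N ^+ n.-1) _ hm hE) => //.
- by move=> y; rewrite subfield_predE in_setE; exact: IHs.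
- by rewrite polyOverXnsubC rpredX.
- exact: coprime_radical_periodic.
- rewrite derivB derivXn derivC subr0 hornerMn hornerXn intrM rmorphXn /= -vN.
  by rewrite exprMn -mulr_natl; ring.
- by rewrite rpredX // aint_conj.
- rewrite dvdzE abszM Euclid_dvdM // negb_or -!dvdzE; apply/andP; split; first exact: pn.
  exact: prime_ndvdzX.
move: xs; apply: adjoinQ_sub; first exact: (poly_values_subfield hm hE hr).
move=> y [Ky|/=].
  exists y%:P; last by rewrite hornerC.
  by rewrite polyOverC; apply: mem_subfield_pred; apply: sub_adjoinQ; left.
rewrite in_cons => /orP[/eqP->|ys].
  by exists 'X; rewrite ?polyOverX ?hornerX.
exists y%:P; last by rewrite hornerC.
by rewrite polyOverC; apply: mem_subfield_pred; apply: sub_adjoinQ; right.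
Qed.

(** Each element of the generated field involves finitely many radicals: the union [T] of the fields
    [adjoin_seq s] is directed, hence a subfield. *)
Lemma adjoin_radicals_periodic (S : set C) :
  (forall y, S y -> exists v a, [/\ coprime_radical v, K a & y = a * v]) ->
  forall x, adjoinQ S x -> x \in aint -> x \in Frobenius_periodic p.
Proof.
move=> hS x Sx xi.
pose T : set C := [set y | exists2 s, {in s, forall v, coprime_radical v} &
                                     adjoin_seq s y].
suff [s hs xs] : T x by exact: adjoin_seq_periodic xs xi.
have cat s t : {in s, forall v, coprime_radical v} ->
    {in t, forall v, coprime_radical v} ->
    {in s ++ t, forall v, coprime_radical v}.
  by move=> hs ht v; rewrite mem_cat => /orP[/hs|/ht].
move: Sx; apply: adjoinQ_sub; last first.
  move=> y /hS[v [a [hv Ka ->]]]; exists [:: v].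
    by move=> w; rewrite inE => /eqP->.
  have Es := adjoinQ_subfield (K `|` [set` [:: v]]).
  apply: (subfieldM Es); apply: sub_adjoinQ; first by left.
  by right; rewrite /= mem_head.
have op (f : C -> C -> C) : (forall F : set C, is_subfield F ->
    forall y z, F y -> F z -> F (f y z)) -> forall y z, T y -> T z -> T (f y z).
  move=> hf y z [s hs ys] [t ht zt]; exists (s ++ t); first exact: cat.
  apply: (hf _ (adjoinQ_subfield _)).
    by apply: adjoin_seqS ys => w; rewrite mem_cat => ->.
  by apply: adjoin_seqS zt => w; rewrite mem_cat orbC => ->.
split; rewrite ?in_setE.
- by exists [::] => //; exact: subfield1 (adjoinQ_subfield _).
- move=> y z; rewrite !in_setE; apply: (op (fun y z => y - z)) => F hF ? ?.
  exact: subfieldB.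
- move=> y z; rewrite !in_setE; apply: (op (fun y z => y / z)) => F hF ? ?.
  exact: subfield_div.
Qed.

End KummerTower.

(** * Entries of the extended Hermitian modular group *)

Section ExtendedModularGroup.
Local Open Scope classical_set_scope.
Local Open Scope ring_scope.
Variables (C : numClosedFieldType) (m n : nat).
Hypotheses (m_gt0 : (0 < m)%N) (n_gt1 : (1 < n)%N).
Let r : C := sqrtC (- m%:R).
Let K : set C := quadratic_field m.
Let O := ring_of_integers K.
Let K_sub : is_subfield K := quadratic_subfield C m.
Let F := field_of_definition (@extended_hermitian_modular_group C n K).

Lemma field_of_definition_entry (M : 'M[C]_(n + n)) i j :
  extended_hermitian_modular_group K M -> F (M i j).
Proof. by move=> GM; apply: sub_adjoinQ; exists M => //; exists i, j. Qed.

Lemma ideal_eq_top (I : set C) : is_ideal O I -> I 1 -> I = O.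
Proof.
move=> [IO _ _ IM] I1; apply/seteqP; split=> // x Ox.
by rewrite -[x]mulr1; exact: IM.
Qed.

Lemma entries_ideal_ideal (L : 'M[C]_(n + n)) : (forall i j, O (L i j)) ->
  is_ideal O (entries_ideal O L).
Proof. by move=> LO; apply: (ideal_gen_ideal K_sub) => _ [i [j ->]]; exact: LO. Qed.

(** The witness is u^-1 times the translation by the Hermitian matrix [S] with entries r and -r at
    two off-diagonal places, available as n > 1. Its determinant is u^(-2n) = 1. *)
Lemma field_of_definition_contains (u : C) : (u ^+ n) ^+ 2 = 1 -> F u /\ F r.
Proof.
have [k nk] : exists k, n = k.+2 by exists n.-2; lia.
pose a : 'I_n := cast_ord (esym nk) ord0.
pose b : 'I_n := cast_ord (esym nk) (Ordinal (isT : 1 < k.+2)%N).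
have ab : a != b by rewrite -val_eqE.
move=> u2; have n0 : (0 < n)%N by lia.
have u0 : u != 0.
  apply/eqP => u0; move/eqP: u2; rewrite u0 -exprM expr0n muln_eq0.
  by rewrite (gtn_eqF n0) eq_sym oner_eq0.
have un : `|u| = 1.
  apply/eqP; rewrite -(@pexpr_eq1 _ `|u| (n * 2)) ?muln_gt0 ?n0 //.
  by rewrite -normrX exprM u2 normr1.
have uu : u^* * u = 1 by rewrite mulrC -normCK un expr1n.
have e1 : u ^+ n = 1 \/ u ^+ n = -1.
  by have /eqP := u2; rewrite -{1}(expr1n _ 2) eqf_sqr => /orP[]/eqP; [left|right].
have Kr : K r := @quadratic_sqrtN C m.
have Or : O r by apply: integersP => //; exact: aint_sqrtN.
have O0 : O 0 := integers_nat K_sub 0.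
have O1 : O 1 := integers_nat K_sub 1.
pose S : 'M[C]_n := \matrix_(i, j) (if (i == a) && (j == b) then r
   else if (i == b) && (j == a) then - r else 0).
pose L : 'M[C]_(n + n) := block_mx 1%:M S 0 1%:M.
have LO i j : O (L i j).
  rewrite /L; rewrite -(splitK i) -(splitK j); case: (split i) => i'; case: (split j) => j' /=.
  - by rewrite block_mxEul mxE; case: eqP.
  - rewrite block_mxEur mxE; do 2?case: ifP => // _; exact: (integersN K_sub).
  - by rewrite block_mxEdl mxE.
  - by rewrite block_mxEdr mxE; case: eqP.
have Sherm : (map_mx Num.conj S)^T = S.
  apply/matrixP => i j; rewrite !mxE [in RHS]andbC andbC.
  case: (eqVneq i a) => [->|ia]; case: (eqVneq j b) => [->|jb] //=;
    rewrite ?(negbTE ab) ?(eq_sym b) ?(negbTE ab) ?andbF /= ?rmorphN /=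
      ?conj_sqrtN ?opprK ?rmorph0 //.
  by case: ifP => _; rewrite ?conj_sqrtN ?rmorph0.
have GM : extended_hermitian_modular_group K (u^-1 *: L).
  split; last first.
    exists u, L; split=> //.
      by case: e1 => ->; [exact: O1 | exact: (integersN K_sub)].
    (* [L] has an entry 1 and u^n is 1 or -1, so both sides of the ideal equation are [O]. *)
    have top : entries_ideal O L = O.
      apply: ideal_eq_top; first exact: entries_ideal_ideal.
      apply: sub_ideal_gen; exists (lshift n a), (lshift n a).
      by rewrite block_mxEul mxE eqxx.
    rewrite [RHS]ideal_eq_top; first last.
    - by rewrite -(expr1n _ n); apply: (ideal_expX K_sub) => //; rewrite top.
    - by apply: (ideal_exp_ideal K_sub) => //; exact: entries_ideal_ideal.
    have un' : O (u ^+ n) by case: e1 => ->; [exact: O1 | exact: (integersN K_sub)].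
    have gI : is_ideal O (ideal_gen O [set u ^+ n]).
      by apply: (ideal_gen_ideal K_sub) => // _ ->.
    apply: ideal_eq_top => //; have [_ _ _ gM] := gI.
    by rewrite -u2 expr2; apply: gM => //; exact: sub_ideal_gen.
  split.
    rewrite detZ det_ublock !det1 !mulr1 exprVn -[in RHS]invr1 -u2.
    by rewrite -exprM muln2 addnn.
  have -> : (map_mx Num.conj (u^-1 *: L))^T *m Jmx C n *m (u^-1 *: L)
      = (u^-1^* * u^-1) *: ((map_mx Num.conj L)^T *m Jmx C n *m L).
    by rewrite map_mxZ [(_ *: _)^T]linearZ /= -scalemxAr -!scalemxAl scalerA mulrC.
  rewrite fmorphV -invfM.
  rewrite uu invr1 scale1r.
  rewrite /L map_block_mx tr_block_mx Sherm !map_mx1 !map_mx0 !trmx1 !trmx0.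
  rewrite /Jmx !mulmx_block !(mul0mx, mulmx0, mul1mx, mulmx1, add0r, addr0).
  by rewrite mulmxN mulmx1 subrr.
have Fs : is_subfield F := adjoinQ_subfield _.
have Fu : F u.
  have := field_of_definition_entry (lshift n a) (lshift n a) GM.
  rewrite mxE block_mxEul mxE eqxx mulr1 => /(subfieldV Fs).
  by rewrite invrK.
split=> //.
have := field_of_definition_entry (lshift n a) (rshift n b) GM.
rewrite mxE block_mxEur mxE !eqxx /= => /(subfieldM Fs Fu).
by rewrite mulVKf.
Qed.

Lemma Jmx_int i j : exists z : int, Jmx C n i j = z%:~R.
Proof.
rewrite /Jmx -(splitK i) -(splitK j); case: (split i) => i'; case: (split j) => j' /=.
- by rewrite block_mxEul mxE; exists 0.
- by rewrite block_mxEur !mxE; exists (- (i' == j')%:Z); rewrite rmorphN.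
- by rewrite block_mxEdl mxE; exists (i' == j')%:Z.
- by rewrite block_mxEdr mxE; exists 0.
Qed.

Variable d : int.
Hypotheses (m_sf : square_free m) (hd : is_discriminant K d).

(* By M^* J M = J the products of an entry and a conjugate entry do not all
   vanish modulo p; the trace form of K being nondegenerate modulo p, some O-linear
   combination v of two entries has norm v v^* prime to p. *)
Lemma extended_group_radical p (M : 'M[C]_(n + n)) :
  prime p -> ~~ (p%:Z %| d)%Z -> extended_hermitian_modular_group K M ->
  exists2 v, coprime_radical K n p v &
    forall i j, exists2 a, K a & M i j = a * v.
Proof.
move=> pp pd [[_ MJ] [u [L [ML LO u0 Oun uI]]]].
have n0 : (0 < n)%N by lia.
have p0 := prime_gt0 pp.
have mL i j : M i j = L i j / u by rewrite ML mxE mulrC.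
have KL i j : K (L i j) := integers_sub (LO i j).
have Mi i j : M i j \in aint.
  have : ideal_exp O (entries_ideal O L) n (L i j ^+ n).
    by apply: (ideal_expX K_sub); apply: sub_ideal_gen; exists i, j.
  rewrite -uI => /(ideal_gen1P K_sub Oun)[o /integers_aint oi eo].
  apply: (@aint_root_monic _ ('X^n - o%:P)).
  - by rewrite monicXnsubC.
  - by rewrite polyOverXnsubC.
  - by rewrite rootE !hornerE mL expr_div_n eo mulrC mulKf ?subrr // expf_neq0.
(* One entry of the unitarity relation, cleared of the denominators of [M], expresses this product
   through entries of [L]. *)
have uu : K (u * u^*).
  pose a := lshift n (Ordinal n0); pose b := rshift n (Ordinal n0).
  have Jab : Jmx C n a b = -1 by rewrite block_mxEur !mxE eqxx.
  have : u * u^* = - \sum_j (\sum_i (L i a)^* * Jmx C n i j) * L j b.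
    have := congr1 (fun A : 'M_(n + n) => A a b) MJ; rewrite Jab mxE => e.
    rewrite -[LHS]mulr1 -[1]opprK -e mulrN; congr (- _).
    rewrite mulr_sumr; apply: eq_bigr => j _.
    rewrite mxE mulr_suml mulr_sumr mulr_suml.
    apply: eq_bigr => i _; rewrite !mxE !mL rmorphM /= fmorphV.
    by field; rewrite u0 conjC_eq0.
  move=> ->; apply: (subfieldN K_sub).
  apply: (subfield_sum K_sub) => j; apply: (subfieldM K_sub) => //.
  apply: (subfield_sum K_sub) => i; apply: (subfieldM K_sub).
    exact: (quadratic_conj m_gt0 (KL _ _)).
  by have [z ->] := Jmx_int i j; exact: (subfield_int K_sub).
(* Otherwise [p] would divide the entry -1 of [J]. *)
have [i [j [k [l zp]]]] : exists i j k l, (M i j)^* * M k l \notin aint_mul p.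
  apply: contrapT => h; have {}h i j k l : (M i j)^* * M k l \in aint_mul p.
    by apply: contrapT => /negP h1; apply: h; exists i, j, k, l.
  pose a := lshift n (Ordinal n0); pose b := rshift n (Ordinal n0).
  have Jab : Jmx C n a b = -1 by rewrite block_mxEur !mxE eqxx.
  have : Jmx C n a b \in aint_mul p.
    rewrite -MJ mxE; apply: rpred_sum => y _; rewrite mxE mulr_suml.
    apply: rpred_sum => x _; rewrite 2!mxE mulrAC aint_mulMr //.
    by have [z ->] := Jmx_int x y; exact: rpred_int.
  rewrite Jab -[-1]/((-1)%:~R) aint_mul_int // dvdzE /= dvdn1 => /eqP p1.
  by rewrite p1 in pp.
(* The integral elements of K u^-1: a module over the integers of K that contains all entries of
   [M], with norms in Z. *)
pose Q v := v \in aint /\ exists2 c, K c & v = c / u.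
have QD v w : Q v -> Q w -> Q (v + w).
  move=> [vi [c Kc ec]] [wi [e Ke ee]]; split; first exact: rpredD.
  by exists (c + e); [exact: (subfieldD K_sub) | rewrite ec ee mulrDl].
have QM a v : K a -> a \in aint -> Q v -> Q (a * v).
  move=> Ka ai [vi [c Kc ec]]; split; first exact: rpredM.
  by exists (a * c); [exact: (subfieldM K_sub) | rewrite ec mulrA].
have Qij x y : Q (M x y) by split=> //; exists (L x y).
have Qint v : Q v -> exists N : int, v * v^* = N%:~R.
  move=> [vi [c Kc ec]]; apply: (quadratic_real_int m_gt0).
  - have -> : v * v^* = c * c^* / (u * u^*).
      by rewrite ec rmorphM /= fmorphV /=; field; rewrite conjC_eq0 u0.
    apply: (subfield_div K_sub) => //; apply: (subfieldM K_sub) => //.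
    exact: (quadratic_conj m_gt0).
  - by rewrite rpredM ?aint_conj.
  - by rewrite rmorphM /= conjCK mulrC.
have Qradical v : Q v -> v * v^* \notin aint_mul p ->
    exists2 v, coprime_radical K n p v &
      forall i j, exists2 a, K a & M i j = a * v.
  move=> Qv pv; have [N vN] := Qint v Qv; have [vi [c Kc ec]] := Qv.
  rewrite vN aint_mul_int // in pv; exists v.
    split=> //; last by exists N.
    rewrite ec expr_div_n; apply: (subfield_div K_sub).
      exact: (subfieldX K_sub).
    exact: integers_sub Oun.
  have c0 : c != 0.
    by apply: contraNneq pv => c0; rewrite -(@aint_mul_int C) // -vN ec c0 !mul0r rpred0.
  move=> x y; exists (L x y / c); first exact: (subfield_div K_sub).
  by rewrite mL ec; field; rewrite u0 c0.
have [s [D [Ks sF sD pD]]] := quadratic_generator m_gt0 m_sf hd pp pd.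
have si := Frobenius_periodic_aint sF.
set x := M i j in zp; set y := M k l in zp.
have [Qx Qy] : Q x /\ Q y by split; exact: Qij.
have [xi yi] : x \in aint /\ y \in aint by split; exact: Mi.
(* If x, y, x + y and x + s y all have norm divisible by [p], polarization makes two
   conjugate-symmetric forms in x and y divisible by [p]. Eliminating between them shows that [p]
   divides [D] times the product in [zp]. *)
have [px|] := boolP (x * x^* \in aint_mul p); last exact: Qradical.
have [py|] := boolP (y * y^* \in aint_mul p); last exact: Qradical.
have [pxy|] := boolP ((x + y) * (x + y)^* \in aint_mul p); last first.
  by apply: Qradical; exact: QD.
have [psxy|] := boolP ((x + s * y) * (x + s * y)^* \in aint_mul p); last first.
  by apply: Qradical; apply: QD => //; exact: QM.
case/negP: zp; apply: (aint_mul_cancel pp pD); first by rewrite rpredM ?aint_conj.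
have tr : x^* * y + x * y^* \in aint_mul p.
  have -> : x^* * y + x * y^* = (x + y) * (x + y)^* - x * x^* - y * y^*.
    by rewrite rmorphD /=; ring.
  by rewrite !rpredB.
have trs : s * x^* * y + s^* * x * y^* \in aint_mul p.
  have -> : s * x^* * y + s^* * x * y^*
      = (x + s * y) * (x + s * y)^* - x * x^* - (s * s^*) * (y * y^*).
    by rewrite rmorphD rmorphM /=; ring.
  by rewrite rpredB ?rpredB // aint_mulMl // rpredM ?aint_conj.
have -> : D%:~R * (x^* * y) = (s - s^*) *
    ((s * x^* * y + s^* * x * y^*) - s^* * (x^* * y + x * y^*)).
  by rewrite -sD; ring.
by rewrite aint_mulMl ?rpredB ?aint_mulMl ?aint_conj.
Qed.

End ExtendedModularGroup.

(** * The ramified primes of the field of definition *)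

Section Ramification.
Variables (C : numClosedFieldType) (m n : nat) (d : int).
Hypotheses (m_sf : square_free m) (n_gt1 : (1 < n)%N).
Hypothesis hd : is_discriminant (@quadratic_field C m) d.
Let G := @extended_hermitian_modular_group C n (quadratic_field m).

Let m_gt0 : (0 < m)%N.
Proof. by case: m m_sf => // /(_ 2 (dvdn0 _)). Qed.

Lemma ramified_dvd p : prime p -> (p%:Z %| n%:Z * d)%Z ->
  ramified_at (field_of_definition G) p.
Proof.
move=> pp; rewrite dvdzE abszM Euclid_dvdM // => pnd.
have Fs : is_subfield (field_of_definition G) := adjoinQ_subfield _.
have Fu u : (u ^+ n) ^+ 2 = 1 -> field_of_definition G u.
  by case/(field_of_definition_contains m_gt0 n_gt1).
have Fr : field_of_definition G (sqrtC (- m%:R)).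
  by have [] := field_of_definition_contains (C := C) m_gt0 n_gt1
    (etrans (congr1 (fun x => x ^+ 2) (expr1n _ n)) (expr1n _ 2)).
have r2 : sqrtC (- m%:R : C) ^+ 2 = - m%:R := sqr_sqrtN C m.
case/orP: pnd => [pn|pd]; last first.
  have := discriminant_primes m_gt0 m_sf hd pp; rewrite dvdzE pd.
  move=> /orP[pm|/andP[/eqP-> /eqP m4]]; last exact: ramified2_sqrtN Fr r2.
  apply: (ramified_sqrtN Fs pp pm _ Fr r2).
  by apply/negP => /m_sf p1; rewrite p1 in pp.
have [p2|p2] := eqVneq p 2%N.
  rewrite p2; apply: ramified2_imaginary => //; apply: Fu.
  (* For even n, i^n is 1 or -1. *)
  have /dvdnP[k ->] : (2 %| n)%N by rewrite -p2.
  by rewrite mulnC exprM sqrCi -exprM mulnC exprM sqrrN !expr1n.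
(* A root of 1 + X + ... + X^(p-1) is a p-th root of unity other than 1, since q(1) = p. *)
pose q : {poly C} := \poly_(i < p) 1.
have [z /rootP qz] : exists z, root q z.
  apply/closed_rootP; rewrite size_poly_eq ?oner_eq0 //.
  by have := prime_gt1 pp; case: (p) => [|[]].
have zp : z ^+ p = 1.
  apply/eqP; rewrite -subr_eq0 subrX1; move: qz; rewrite horner_poly.
  by under eq_bigr do rewrite mul1r; move->; rewrite mulr0.
have z1 : z != 1.
  apply: contraPneq qz => ->; rewrite horner_poly.
  under eq_bigr do rewrite mul1r expr1n.
  by rewrite sumr_const card_ord; apply/eqP; rewrite pnatr_eq0 -lt0n prime_gt0.
apply: (ramified_unity_root Fs pp p2 _ zp z1); apply: Fu.
by have /dvdnP[k ->] : (p %| n)%N := pn; rewrite mulnC exprM zp !expr1n.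
Qed.

Lemma unramified_ndvd p : prime p -> ~~ (p%:Z %| n%:Z * d)%Z ->
  ~ ramified_at (field_of_definition G) p.
Proof.
move=> pp; rewrite dvdzE abszM Euclid_dvdM // negb_or => /andP[pn pd].
have Ks := quadratic_subfield C m.
apply: (Frobenius_periodic_unramified (adjoinQ_subfield _) pp).
apply: (adjoin_radicals_periodic Ks pp pn).
  by move=> x; exact: (quadratic_Frobenius_periodic m_gt0 m_sf hd pp).
move=> _ [M GM [i [j ->]]].
have [v hv /(_ i j)[a Ka e]] := extended_group_radical m_gt0 n_gt1 m_sf hd pp pd GM.
by exists v, a.
Qed.

End Ramification.

(** The case n = 1 is excluded: the group is then SL_2(Z), and its field of definition Q is
    unramified everywhere, whereas [d] has prime divisors. *)
Theorem theorem4 (R : realType) (m n : nat) (d : int)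
    (hm : square_free m) (hn : (1 < n)%N)
    (hd : is_discriminant (@quadratic_field R[i] m) d) :
  forall p : nat, prime p ->
    ramified_at
      (field_of_definition
         (@extended_hermitian_modular_group R[i] n (quadratic_field m))) p
    <-> (p%:Z %| n%:Z * d)%Z.
Proof.
move=> p pp; split; last exact: ramified_dvd.
by move=> ram; apply: contrapT => /negP/(unramified_ndvd hm hn hd pp).
Qed.
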